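(* For any terms $\mathbf t,\mathbf t'$, any context $\Gamma$ and any type $T$ of the calculus $\lambda^{\mathrm{vec}}_{\mathrm R}$: if $\mathbf t\to\mathbf t'$ and $\Gamma\vdash\mathbf t:T$ is derivable, then $\Gamma\vdash\mathbf t':T$ is derivable.
   Context: Fix a commutative ring $(\mathsf S,+,\times)$ of scalars. Terms of $\lambda^{\mathrm{vec}}_{\mathrm R}$: $\mathbf t ::= x\mid \lambda x.\mathbf t\mid (\mathbf t)\,\mathbf t\mid \alpha\cdot\mathbf t\mid \mathbf t+\mathbf t$, with $\alpha\in\mathsf S$ (there is no zero term). Basis terms are variables and abstractions: $\mathbf b ::= x\mid \lambda x.\mathbf t$. The one-step reduction $\to$ is the closure under the contexts $\alpha\cdot[-]$, $\mathbf u+[-]$, $(\mathbf u)\,[-]$, $([-])\,\mathbf u$, $\lambda x.[-]$ of the following rules. Group E: $1\cdot\mathbf t\to\mathbf t$; $\alpha\cdot(\beta\cdot\mathbf t)\to(\alpha\times\beta)\cdot\mathbf t$; $\alpha\cdot(\mathbf t+\mathbf r)\to\alpha\cdot\mathbf t+\alpha\cdot\mathbf r$. Group F: $\alpha\cdot\mathbf t+\beta\cdot\mathbf t\to(\alpha+\beta)\cdot\mathbf t$; $\alpha\cdot\mathbf t+\mathbf t\to(\alpha+1)\cdot\mathbf t$; $\mathbf t+\mathbf t\to(1+1)\cdot\mathbf t$. Group A: $(\mathbf t+\mathbf r)\,\mathbf u\to(\mathbf t)\,\mathbf u+(\mathbf r)\,\mathbf u$; $(\mathbf t)\,(\mathbf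 r+\mathbf u)\to(\mathbf t)\,\mathbf r+(\mathbf t)\,\mathbf u$; $(\alpha\cdot\mathbf t)\,\mathbf r\to\alpha\cdot(\mathbf t)\,\mathbf r$; $(\mathbf t)\,(\alpha\cdot\mathbf r)\to\alpha\cdot(\mathbf t)\,\mathbf r$. Group B: $(\lambda x.\mathbf t)\,\mathbf b\to\mathbf t[\mathbf b/x]$ for $\mathbf b$ a basis term. Types: general types $T::=U\mid\alpha\cdot T\mid T+T\mid \mathbb X$ and unit types $U::=X\mid U\to T\mid\forall X.U\mid\forall\mathbb X.U$, where $X$ ranges over unit type variables and $\mathbb X$ over general type variables. $\equiv$ is the smallest congruence on types with $1\cdot T\equiv T$, $\alpha\cdot(\beta\cdot T)\equiv(\alpha\times\beta)\cdot T$, $\alpha\cdot T+\alpha\cdot R\equiv\alpha\cdot(T+R)$, $\alpha\cdot T+\beta\cdot T\equiv(\alpha+\beta)\cdot T$, $T+R\equiv R+T$, $T+(R+S)\equiv(T+R)+S$. In $T[A/X]$, $A$ is a unit type when $X$ is a unit variable and any type when $X$ is a general variable. A context $\Gamma$ is a finite set of declarations $x:U$ with $U$ unit. Typing rules: (ax) $\Gamma,x:U\vdash x:U$; ($\equiv$) from $\Gamma\vdash\mathbf t:T$ and $R\equiv T$ infer $\Gamma\vdash\mathbf t:R$; ($\to_I$) from $\Gamma,x:U\vdash\mathbf t:T$ infer $\Gamma\vdash\lambda x.\mathbf t:U\to T$; ($\to_E$) from $\Gamma\vdash\mathbf t:\sum_{i=1}^n\alpha_i\cdot\forall\vec X.(U\to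 T_i)$ and $\Gamma\vdash\mathbf r:\sum_{j=1}^m\beta_j\cdot U[\vec A_j/\vec X]$ infer $\Gamma\vdash(\mathbf t)\,\mathbf r:\sum_{i=1}^n\sum_{j=1}^m(\alpha_i\times\beta_j)\cdot T_i[\vec A_j/\vec X]$; ($\forall_I$) from $\Gamma\vdash\mathbf t:\sum_{i=1}^n\alpha_i\cdot U_i$ and $X\notin FV(\Gamma)$ infer $\Gamma\vdash\mathbf t:\sum_{i=1}^n\alpha_i\cdot\forall X.U_i$; ($\forall_E$) from $\Gamma\vdash\mathbf t:\sum_{i=1}^n\alpha_i\cdot\forall X.U_i$ infer $\Gamma\vdash\mathbf t:\sum_{i=1}^n\alpha_i\cdot U_i[A/X]$; ($+_I$) from $\Gamma\vdash\mathbf t:T$ and $\Gamma\vdash\mathbf r:R$ infer $\Gamma\vdash\mathbf t+\mathbf r:T+R$; ($1_E$) from $\Gamma\vdash1\cdot\mathbf t:T$ infer $\Gamma\vdash\mathbf t:T$; ($S$) from $\Gamma\vdash\mathbf t:T_i$ for all $i\in\{1,\dots,n\}$ infer $\Gamma\vdash(\sum_{i=1}^n\alpha_i)\cdot\mathbf t:\sum_{i=1}^n\alpha_i\cdot T_i$. (Here $X$ in $\forall_I,\forall_E$ may be either kind of variable.) *)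

(* Defs.v *)
From mathcomp Require Import all_boot all_algebra.

Set Implicit Arguments.
Unset Strict Implicit.
Unset Printing Implicit Defensive.

Import GRing.Theory.
Local Open Scope ring_scope.

(* Terms and types are taken up to alpha-equivalence: all binders, in terms   *)
(* and in types, use de Bruijn indices.                                       *)

Definition scons (A : Type) (a : A) (s : nat -> A) (n : nat) : A :=
  if n is m.+1 then s m else a.

Definition upren (r : nat -> nat) : nat -> nat := scons 0%N (fun n => (r n).+1).

Inductive term (K : comPzRingType) : Type :=
| Var of nat
| Lam of term K
| App of term K & term K
| Scal of K & term K
| Plus of term K & term K.

Arguments Var {K} _.

Definition basis (K : comPzRingType) (t : term K) : bool :=
  match t with
  | Var _ | Lam _ => true
  | App _ _ | Scal _ _ | Plus _ _ => false
  end.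

Fixpoint ren (K : comPzRingType) (r : nat -> nat) (t : term K) : term K :=
  match t with
  | Var n => Var (r n)
  | Lam t1 => Lam (ren (upren r) t1)
  | App t1 t2 => App (ren r t1) (ren r t2)
  | Scal a t1 => Scal a (ren r t1)
  | Plus t1 t2 => Plus (ren r t1) (ren r t2)
  end.

Definition up (K : comPzRingType) (s : nat -> term K) : nat -> term K :=
  scons (Var 0) (fun n => ren succn (s n)).

Fixpoint subst (K : comPzRingType) (s : nat -> term K) (t : term K) : term K :=
  match t with
  | Var n => s n
  | Lam t1 => Lam (subst (up s) t1)
  | App t1 t2 => App (subst s t1) (subst s t2)
  | Scal a t1 => Scal a (subst s t1)
  | Plus t1 t2 => Plus (subst s t1) (subst s t2)
  end.

(* t[b/x], where x is the variable of index 0 in t *)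
Definition subst1 (K : comPzRingType) (b t : term K) : term K :=
  subst (scons b Var) t.

Inductive step (K : comPzRingType) : term K -> term K -> Prop :=
| step_one t : step (Scal 1 t) t
| step_scal a b t : step (Scal a (Scal b t)) (Scal (a * b) t)
| step_dist a t r : step (Scal a (Plus t r)) (Plus (Scal a t) (Scal a r))
| step_fact a b t : step (Plus (Scal a t) (Scal b t)) (Scal (a + b) t)
| step_fact1 a t : step (Plus (Scal a t) t) (Scal (a + 1) t)
| step_fact11 t : step (Plus t t) (Scal (1 + 1) t)
| step_plus_app t r u :
    step (App (Plus t r) u) (Plus (App t u) (App r u))
| step_app_plus t r u :
    step (App t (Plus r u)) (Plus (App t r) (App t u))
| step_scal_app a t r : step (App (Scal a t) r) (Scal a (App t r))
| step_app_scal a t r : step (App t (Scal a r)) (Scal a (App t r))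
| step_beta t b : basis b -> step (App (Lam t) b) (subst1 b t)
| step_ctx_scal a t t' : step t t' -> step (Scal a t) (Scal a t')
| step_ctx_plus u t t' : step t t' -> step (Plus u t) (Plus u t')
| step_ctx_appr u t t' : step t t' -> step (App u t) (App u t')
| step_ctx_appl u t t' : step t t' -> step (App t u) (App t' u)
| step_ctx_lam t t' : step t t' -> step (Lam t) (Lam t').

(* The two kinds of type variables; each kind has its own de Bruijn indices,  *)
(* so that a binder of one kind does not shift the variables of the other.    *)
Inductive kind : Type := KUnit | KGen.

Inductive gtype (K : comPzRingType) : Type :=
| GUnit of utype K
| GScal of K & gtype K
| GPlus of gtype K & gtype K
| GVar of nat
with utype (K : comPzRingType) : Type :=
| UVar of nat
| UArr of utype K & gtype K
| UAll of kind & utype K.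

Arguments GVar {K} _.
Arguments UVar {K} _.

Definition upren_at (b k : kind) (r : nat -> nat) : nat -> nat :=
  match b, k with
  | KUnit, KUnit | KGen, KGen => upren r
  | _, _ => r
  end.

Fixpoint gren (K : comPzRingType) (ru rg : nat -> nat) (T : gtype K)
    {struct T} : gtype K :=
  match T with
  | GUnit U => GUnit (uren ru rg U)
  | GScal a T1 => GScal a (gren ru rg T1)
  | GPlus T1 T2 => GPlus (gren ru rg T1) (gren ru rg T2)
  | GVar n => GVar (rg n)
  end
with uren (K : comPzRingType) (ru rg : nat -> nat) (U : utype K)
    {struct U} : utype K :=
  match U with
  | UVar n => UVar (ru n)
  | UArr U1 T => UArr (uren ru rg U1) (gren ru rg T)
  | UAll k U1 => UAll k (uren (upren_at k KUnit ru) (upren_at k KGen rg) U1)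
  end.

Definition shift_at (b k : kind) : nat -> nat :=
  match b, k with
  | KUnit, KUnit | KGen, KGen => succn
  | _, _ => id
  end.

Definition gshift (K : comPzRingType) (k : kind) : gtype K -> gtype K :=
  gren (shift_at k KUnit) (shift_at k KGen).

Definition ushift (K : comPzRingType) (k : kind) : utype K -> utype K :=
  uren (shift_at k KUnit) (shift_at k KGen).

Definition upu (K : comPzRingType) (k : kind) (su : nat -> utype K) :
    nat -> utype K :=
  let su' := fun n => ushift k (su n) in
  if k is KUnit then scons (UVar 0) su' else su'.

Definition upg (K : comPzRingType) (k : kind) (sg : nat -> gtype K) :
    nat -> gtype K :=
  let sg' := fun n => gshift k (sg n) in
  if k is KGen then scons (GVar 0) sg' else sg'.

(* Simultaneous substitution: unit variables are replaced by unit types, and  *)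
(* general variables by arbitrary types.                                      *)
Fixpoint gsubst (K : comPzRingType) (su : nat -> utype K) (sg : nat -> gtype K)
    (T : gtype K) {struct T} : gtype K :=
  match T with
  | GUnit U => GUnit (usubst su sg U)
  | GScal a T1 => GScal a (gsubst su sg T1)
  | GPlus T1 T2 => GPlus (gsubst su sg T1) (gsubst su sg T2)
  | GVar n => sg n
  end
with usubst (K : comPzRingType) (su : nat -> utype K) (sg : nat -> gtype K)
    (U : utype K) {struct U} : utype K :=
  match U with
  | UVar n => su n
  | UArr U1 T => UArr (usubst su sg U1) (gsubst su sg T)
  | UAll k U1 => UAll k (usubst (upu k su) (upg k sg) U1)
  end.

Inductive targ (K : comPzRingType) : Type :=
| AUnit of utype K
| AGen of gtype K.

Definition kind_of (K : comPzRingType) (A : targ K) : kind :=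
  if A is AUnit _ then KUnit else KGen.

(* [foralls [:: k1; ..; kp] U] binds X1 outermost and Xp innermost. The types *)
(* [:: A1; ..; Ap] that instantiate X1, .., Xp all live outside these binders *)
(* and are substituted simultaneously; [inst_u] and [inst_g] push them in     *)
(* order, so that the last one of each kind gets index 0.                     *)
Definition foralls (K : comPzRingType) (ks : seq kind) (U : utype K) :
    utype K :=
  foldr (@UAll K) U ks.

Definition inst_u (K : comPzRingType) (As : seq (targ K)) : nat -> utype K :=
  foldl (fun s A => if A is AUnit V then scons V s else s) UVar As.

Definition inst_g (K : comPzRingType) (As : seq (targ K)) : nat -> gtype K :=
  foldl (fun s A => if A is AGen T then scons T s else s) GVar As.

Definition ginst (K : comPzRingType) (As : seq (targ K)) : gtype K -> gtype K :=
  gsubst (inst_u As) (inst_g As).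

Definition uinst (K : comPzRingType) (As : seq (targ K)) : utype K -> utype K :=
  usubst (inst_u As) (inst_g As).

(* The congruence is a relation on all types, unit types being types: the     *)
(* premises on unit subterms are equivalences of the corresponding types.     *)
Inductive tyeq (K : comPzRingType) : gtype K -> gtype K -> Prop :=
| tyeq_one T : tyeq (GScal 1 T) T
| tyeq_scal a b T : tyeq (GScal a (GScal b T)) (GScal (a * b) T)
| tyeq_dist a T R :
    tyeq (GPlus (GScal a T) (GScal a R)) (GScal a (GPlus T R))
| tyeq_fact a b T :
    tyeq (GPlus (GScal a T) (GScal b T)) (GScal (a + b) T)
| tyeq_comm T R : tyeq (GPlus T R) (GPlus R T)
| tyeq_assoc T R Q :
    tyeq (GPlus T (GPlus R Q)) (GPlus (GPlus T R) Q)
| tyeq_refl T : tyeq T T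
| tyeq_sym T R : tyeq T R -> tyeq R T
| tyeq_trans T R Q : tyeq T R -> tyeq R Q -> tyeq T Q
| tyeq_GScal a T T' : tyeq T T' -> tyeq (GScal a T) (GScal a T')
| tyeq_GPlus T T' R R' :
    tyeq T T' -> tyeq R R' -> tyeq (GPlus T R) (GPlus T' R')
| tyeq_UArr U U' T T' :
    tyeq (GUnit U) (GUnit U') -> tyeq T T' ->
    tyeq (GUnit (UArr U T)) (GUnit (UArr U' T'))
| tyeq_UAll k U U' :
    tyeq (GUnit U) (GUnit U') ->
    tyeq (GUnit (UAll k U)) (GUnit (UAll k U')).

(* There is no zero type, so sums of types are nonempty: F 0 + .. + F n. *)
Fixpoint gsum (K : comPzRingType) (n : nat) :
    ('I_n.+1 -> gtype K) -> gtype K :=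
  match n with
  | 0 => fun F => F ord0
  | m.+1 => fun F => GPlus (F ord0) (gsum (fun i : 'I_m.+1 => F (lift ord0 i)))
  end.

(* The variable of index i is declared with the i-th type of the context. *)
Definition ctx (K : comPzRingType) : Type := seq (utype K).

(* In [ty_forallI], X not free in the context is rendered, as usual with de   *)
(* Bruijn indices, by shifting the context of the premise.                    *)
Inductive typed (K : comPzRingType) : ctx K -> term K -> gtype K -> Prop :=
| ty_ax G x U : onth G x = Some U -> typed G (Var x) (GUnit U)
| ty_equiv G t T R : typed G t T -> tyeq R T -> typed G t R
| ty_arrI G t U T : typed (U :: G) t T -> typed G (Lam t) (GUnit (UArr U T))
| ty_arrE G t r n m (a : 'I_n.+1 -> K) (b : 'I_m.+1 -> K) (Xs : seq kind)
    (U : utype K) (T : 'I_n.+1 -> gtype K) (As : 'I_m.+1 -> seq (targ K)) :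
    (forall j, map (@kind_of K) (As j) = Xs) ->
    typed G t (gsum (fun i => GScal (a i) (GUnit (foralls Xs (UArr U (T i)))))) ->
    typed G r (gsum (fun j => GScal (b j) (GUnit (uinst (As j) U)))) ->
    typed G (App t r)
      (gsum (fun i => gsum (fun j => GScal (a i * b j) (ginst (As j) (T i)))))
| ty_forallI G t n (a : 'I_n.+1 -> K) (k : kind) (U : 'I_n.+1 -> utype K) :
    typed (map (ushift k) G) t (gsum (fun i => GScal (a i) (GUnit (U i)))) ->
    typed G t (gsum (fun i => GScal (a i) (GUnit (UAll k (U i)))))
| ty_forallE G t n (a : 'I_n.+1 -> K) (k : kind) (U : 'I_n.+1 -> utype K)
    (A : targ K) :
    kind_of A = k ->
    typed G t (gsum (fun i => GScal (a i) (GUnit (UAll k (U i))))) ->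
    typed G t (gsum (fun i => GScal (a i) (GUnit (uinst [:: A] (U i)))))
| ty_plusI G t r T R :
    typed G t T -> typed G r R -> typed G (Plus t r) (GPlus T R)
| ty_oneE G t T : typed G (Scal 1 t) T -> typed G t T
| ty_S G t n (a : 'I_n.+1 -> K) (T : 'I_n.+1 -> gtype K) :
    (forall i, typed G t (T i)) ->
    typed G (Scal (\sum_(i < n.+1) a i) t) (gsum (fun i => GScal (a i) (T i))).

(* Main.v *)
Require Import Defs.
From mathcomp Require Import all_boot all_algebra ring.
From Stdlib Require Import FunctionalExtensionality.

Set Implicit Arguments.
Unset Strict Implicit.
Unset Printing Implicit Defensive.

Import GRing.Theory.
Local Open Scope ring_scope.

(** Modulo [tyeq], a type is a finite nonempty set of atoms weighted by
    scalars. Every rule acting on sums of unit types (forall introduction and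
    elimination, and each of the two premises of the application rule) sends
    [sum_i a_i . f j_i] to [sum_i a_i . g j_i] for some maps [f] and [g] on
    indices. Such a passage from [R] to [S] follows any decomposition of [R]:
    if [R] is equivalent to [R1 + R2], then [S] splits accordingly, and if [R]
    is equivalent to [a . R'], then [S] is [a . S1 + S2 - S3] with each [Si]
    above [R'], the difference being absorbed by rule S since it does not
    change the sum of the scalars. When [f] is not injective this needs
    subtraction, hence a ring of scalars. It follows that the types of [a . t]
    are the combinations of total weight [a] of types of [t], that the types of
    [t + r] are sums of types of [t] and [r], and that application is
    bilinear. For beta reduction, the types of a basis term are affine
    combinations of unit types of the same term. *)

(** * Linear identities between types *)

Lemma tyeq_plusACA (K : comPzRingType) (T1 T2 R1 R2 : gtype K) :
  tyeq (GPlus (GPlus T1 T2) (GPlus R1 R2)) (GPlus (GPlus T1 R1) (GPlus T2 R2)).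
Proof.
apply: tyeq_trans (tyeq_sym (tyeq_assoc _ _ _)) _.
apply: tyeq_trans (tyeq_assoc _ _ _).
apply: tyeq_GPlus (tyeq_refl _) _.
apply: tyeq_trans (tyeq_assoc _ _ _) _.
apply: tyeq_trans (tyeq_sym (tyeq_assoc _ _ _)).
exact: tyeq_GPlus (tyeq_comm _ _) (tyeq_refl _).
Qed.

Lemma tyeq_plusAC (K : comPzRingType) (T R Q : gtype K) :
  tyeq (GPlus T (GPlus R Q)) (GPlus R (GPlus T Q)).
Proof.
apply: tyeq_trans (tyeq_assoc _ _ _) _.
apply: tyeq_trans (tyeq_sym (tyeq_assoc _ _ _)).
exact: tyeq_GPlus (tyeq_comm _ _) (tyeq_refl _).
Qed.

Inductive lexp (K : comPzRingType) : Type :=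
| LVar of nat
| LScal of K & lexp K
| LPlus of lexp K & lexp K.

Arguments LVar {K} _.

Fixpoint leval (K : comPzRingType) (env : nat -> gtype K) (e : lexp K) :
    gtype K :=
  match e with
  | LVar i => env i
  | LScal a e1 => GScal a (leval env e1)
  | LPlus e1 e2 => GPlus (leval env e1) (leval env e2)
  end.

Definition oplus (A : Type) (add : A -> A -> A) (x y : option A) : option A :=
  match x, y with
  | Some a, Some b => Some (add a b)
  | Some a, None => Some a
  | None, _ => y
  end.

(* An absent type differs from a type with coefficient 0, since [GScal 0 T]   *)
(* cannot be erased from a sum: coefficients are therefore optional.          *)
Fixpoint lcoef (K : comPzRingType) (e : lexp K) (i : nat) : option K :=
  match e with
  | LVar j => if i == j then Some 1 else None
  | LScal a e1 => omap ( *%R a) (lcoef e1 i)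
  | LPlus e1 e2 => oplus +%R (lcoef e1 i) (lcoef e2 i)
  end.

Fixpoint lbound (K : comPzRingType) (e : lexp K) : nat :=
  match e with
  | LVar j => j.+1
  | LScal a e1 => lbound e1
  | LPlus e1 e2 => maxn (lbound e1) (lbound e2)
  end.

Fixpoint lnorm (K : comPzRingType) (env : nat -> gtype K) (n : nat)
    (c : nat -> option K) : option (gtype K) :=
  if n is m.+1 then
    oplus (@GPlus K) (omap (fun a => GScal a (env m)) (c m)) (lnorm env m c)
  else None.

Definition otyeq (K : comPzRingType) (x y : option (gtype K)) : Prop :=
  match x, y with
  | Some T, Some R => tyeq T R
  | None, None => True
  | _, _ => False
  end.

Lemma otyeq_refl (K : comPzRingType) (x : option (gtype K)) : otyeq x x.
Proof. by case: x => //= T; apply: tyeq_refl. Qed.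

Lemma otyeq_sym (K : comPzRingType) (x y : option (gtype K)) :
  otyeq x y -> otyeq y x.
Proof. by case: x; case: y => //= T R; apply: tyeq_sym. Qed.

Lemma otyeq_trans (K : comPzRingType) (x y z : option (gtype K)) :
  otyeq x y -> otyeq y z -> otyeq x z.
Proof. by case: x; case: y; case: z => //= T R Q; apply: tyeq_trans. Qed.

Lemma otyeq_oplus (K : comPzRingType) (x x' y y' : option (gtype K)) :
  otyeq x x' -> otyeq y y' ->
  otyeq (oplus (@GPlus K) x y) (oplus (@GPlus K) x' y').
Proof.
by case: x; case: x'; case: y; case: y' => //= T R Q S; apply: tyeq_GPlus.
Qed.

Lemma otyeq_omap (K : comPzRingType) (a : K) (x y : option (gtype K)) :
  otyeq x y -> otyeq (omap (GScal a) x) (omap (GScal a) y).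
Proof. by case: x; case: y => //= T R; apply: tyeq_GScal. Qed.

Lemma eq_lnorm (K : comPzRingType) (env : nat -> gtype K) n c d :
  c =1 d -> lnorm env n c = lnorm env n d.
Proof. by move=> cd; elim: n => //= n ->; rewrite cd. Qed.

Lemma lnorm_plus (K : comPzRingType) (env : nat -> gtype K) n c d :
  otyeq (oplus (@GPlus K) (lnorm env n c) (lnorm env n d))
    (lnorm env n (fun i => oplus +%R (c i) (d i))).
Proof.
elim: n => //= n IH.
apply: otyeq_trans (otyeq_oplus (otyeq_refl _) IH).
case: (c n) (d n) => [a|] [b|] /=;
  case: (lnorm env n c) (lnorm env n d) => [T|] [R|] //=;
  do ?[exact: tyeq_refl | exact: tyeq_fact | exact: tyeq_plusAC
      | exact: tyeq_sym (tyeq_assoc _ _ _)].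
- apply: tyeq_trans (tyeq_plusACA _ _ _ _) _.
  exact: tyeq_GPlus (tyeq_fact _ _ _) (tyeq_refl _).
- apply: tyeq_trans (tyeq_sym (tyeq_assoc _ _ _)) _.
  apply: tyeq_trans (tyeq_GPlus (tyeq_refl _) (tyeq_comm _ _)) _.
  apply: tyeq_trans (tyeq_assoc _ _ _) _.
  exact: tyeq_GPlus (tyeq_fact _ _ _) (tyeq_refl _).
- apply: tyeq_trans (tyeq_assoc _ _ _) _.
  exact: tyeq_GPlus (tyeq_fact _ _ _) (tyeq_refl _).
- exact: tyeq_comm.
Qed.

Lemma lnorm_scal (K : comPzRingType) (env : nat -> gtype K) n a c :
  otyeq (omap (GScal a) (lnorm env n c))
    (lnorm env n (fun i => omap ( *%R a) (c i))).
Proof.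
elim: n => //= n IH.
apply: otyeq_trans (otyeq_oplus (otyeq_refl _) IH).
case: (c n) => [b|] /=; case: (lnorm env n c) => [T|] //=;
  do ?[exact: tyeq_refl | exact: tyeq_scal].
apply: tyeq_trans (tyeq_sym (tyeq_dist _ _ _)) _.
exact: tyeq_GPlus (tyeq_scal _ _ _) (tyeq_refl _).
Qed.

Lemma lnorm_var (K : comPzRingType) (env : nat -> gtype K) n j :
  (j < n)%N ->
  otyeq (Some (env j))
    (lnorm env n (fun i => if i == j then Some 1 else None)).
Proof.
have none m : (m <= j)%N ->
    lnorm env m (fun i => if i == j then Some 1 else None) = None.
  by elim: m => //= m IH mj; rewrite IH ?(ltnW mj) // ltn_eqF.
elim: n => //= n IH; rewrite ltnS leq_eqVlt => /orP[/eqP<-|jn].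
  by rewrite eqxx none //=; apply/tyeq_sym/tyeq_one.
by rewrite gtn_eqF //=; apply: IH.
Qed.

Lemma leval_lnorm (K : comPzRingType) (env : nat -> gtype K) n e :
  (lbound e <= n)%N -> otyeq (Some (leval env e)) (lnorm env n (lcoef e)).
Proof.
elim: e => [j|a e IH|e1 IH1 e2 IH2] /=.
- exact: lnorm_var.
- move=> /IH en.
  exact: otyeq_trans (otyeq_omap a en) (lnorm_scal _ _ _ _).
- rewrite geq_max => /andP[/IH1 e1n /IH2 e2n].
  exact: otyeq_trans (otyeq_oplus e1n e2n) (lnorm_plus _ _ _ _).
Qed.

Lemma leval_eq (K : comPzRingType) (env : nat -> gtype K) e1 e2 :
  lcoef e1 =1 lcoef e2 -> tyeq (leval env e1) (leval env e2).
Proof.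
move=> ec; set n := maxn (lbound e1) (lbound e2).
have e1n := @leval_lnorm _ env n e1 (leq_maxl _ _).
have e2n := @leval_lnorm _ env n e2 (leq_maxr _ _).
rewrite (eq_lnorm _ _ ec) in e1n.
exact: otyeq_trans e1n (otyeq_sym e2n).
Qed.

Ltac lex_index T l :=
  lazymatch l with
  | T :: _ => constr:(O)
  | _ :: ?l' => let i := lex_index T l' in constr:(S i)
  end.

Ltac lex_member T l :=
  lazymatch l with
  | nil => constr:(false)
  | T :: _ => constr:(true)
  | _ :: ?l' => lex_member T l'
  end.

Ltac lex_atoms T l :=
  lazymatch T with
  | GScal _ ?R => lex_atoms R l
  | GPlus ?R1 ?R2 => let l1 := lex_atoms R1 l in lex_atoms R2 l1
  | _ => lazymatch lex_member T l with
         | true => l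
         | false => constr:(T :: l)
         end
  end.

Ltac lex_reify K T l :=
  lazymatch T with
  | GScal ?a ?R => let e := lex_reify K R l in constr:(LScal a e)
  | GPlus ?R1 ?R2 =>
      let e1 := lex_reify K R1 l in
      let e2 := lex_reify K R2 l in constr:(LPlus e1 e2)
  | _ => let i := lex_index T l in constr:(@LVar K i)
  end.

Ltac lex_coefs l :=
  lazymatch l with
  | nil => by []
  | _ :: ?l' => case; [cbn; congr Some; ring | lex_coefs l']
  end.

Ltac tyring :=
  lazymatch goal with
  | |- @tyeq ?K ?T ?R =>
      let l := lex_atoms T (@nil (gtype K)) in
      let l := lex_atoms R l in
      let e1 := lex_reify K T l in
      let e2 := lex_reify K R l in
      refine (@leval_eq K (nth (@GVar K 0) l) e1 e2 _);
      lex_coefs l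
  end.

(** * Finite sums of types *)

Lemma gsum_eq (K : comPzRingType) n (F F' : 'I_n.+1 -> gtype K) :
  (forall i, tyeq (F i) (F' i)) -> tyeq (gsum F) (gsum F').
Proof.
elim: n F F' => [|n IH] F F' FF' /=; first exact: FF'.
by apply: tyeq_GPlus => //; apply: IH.
Qed.

Lemma gsum_scal (K : comPzRingType) n (a : K) (F : 'I_n.+1 -> gtype K) :
  tyeq (GScal a (gsum F)) (gsum (fun i => GScal a (F i))).
Proof.
elim: n F => [|n IH] F /=; first exact: tyeq_refl.
apply: tyeq_trans (tyeq_sym (tyeq_dist _ _ _)) _.
exact: tyeq_GPlus (tyeq_refl _) (IH _).
Qed.

Lemma gsum_plus (K : comPzRingType) n (F F' : 'I_n.+1 -> gtype K) :
  tyeq (gsum (fun i => GPlus (F i) (F' i))) (GPlus (gsum F) (gsum F')).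
Proof.
elim: n F F' => [|n IH] F F' /=; first exact: tyeq_refl.
apply: tyeq_trans (tyeq_plusACA _ _ _ _).
exact: tyeq_GPlus (tyeq_refl _) (IH _ _).
Qed.

Lemma gsum_exchange (K : comPzRingType) n m
    (F : 'I_n.+1 -> 'I_m.+1 -> gtype K) :
  tyeq (gsum (fun i => gsum (F i))) (gsum (fun j => gsum (F^~ j))).
Proof.
elim: n F => [|n IH] F /=; first exact: tyeq_refl.
apply: tyeq_trans (tyeq_sym (gsum_plus _ _)).
exact: tyeq_GPlus (tyeq_refl _) (IH (fun i => F (lift ord0 i))).
Qed.

Lemma gsum_split (K : comPzRingType) n m
    (F : 'I_(n.+1 + m.+1) -> gtype K) :
  tyeq (@gsum K (n + m.+1) F)
    (GPlus (gsum (fun i => F (lshift m.+1 i)))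
           (gsum (fun j => F (rshift n.+1 j)))).
Proof.
elim: n F => [|n IH] F /=.
  have -> : lshift m.+1 ord0 = ord0 :> 'I_(1 + m.+1) by apply: val_inj.
  apply: tyeq_GPlus (tyeq_refl _) _; apply: gsum_eq => j.
  have -> : lift ord0 j = rshift 1 j by apply: val_inj.
  exact: tyeq_refl.
apply: tyeq_trans (tyeq_GPlus (tyeq_refl _) (IH (fun i => F (lift ord0 i)))) _.
apply: tyeq_trans (tyeq_assoc _ _ _) _.
have -> : lshift m.+1 ord0 = ord0 :> 'I_(n.+2 + m.+1) by apply: val_inj.
apply: tyeq_GPlus; first apply: tyeq_GPlus (tyeq_refl _) _;
  apply: gsum_eq => i.
- have -> : lift ord0 (lshift m.+1 i) = lshift m.+1 (lift ord0 i) by apply: val_inj.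
  exact: tyeq_refl.
- have -> : lift ord0 (rshift n.+1 i) = rshift n.+2 i by apply: val_inj.
  exact: tyeq_refl.
Qed.

(** * Formal linear combinations *)

Inductive tree (K : comPzRingType) (J : Type) : Type :=
| Leaf of K & J
| Node of tree K J & tree K J.

Fixpoint teval (K : comPzRingType) (J : Type) (h : J -> gtype K)
    (x : tree K J) : gtype K :=
  match x with
  | Leaf a j => GScal a (h j)
  | Node x1 x2 => GPlus (teval h x1) (teval h x2)
  end.

Fixpoint tweight (K : comPzRingType) (J : Type) (x : tree K J) : K :=
  match x with
  | Leaf a _ => a
  | Node x1 x2 => tweight x1 + tweight x2
  end.

Fixpoint tall (K : comPzRingType) (J : Type) (ok : J -> Prop)
    (x : tree K J) : Prop :=
  match x with
  | Leaf _ j => ok j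
  | Node x1 x2 => tall ok x1 /\ tall ok x2
  end.

Fixpoint tscale (K : comPzRingType) (J : Type) (c : K) (x : tree K J) :
    tree K J :=
  match x with
  | Leaf a j => Leaf (c * a) j
  | Node x1 x2 => Node (tscale c x1) (tscale c x2)
  end.

Lemma teval_scale (K : comPzRingType) J (h : J -> gtype K) c x :
  tyeq (teval h (tscale c x)) (GScal c (teval h x)).
Proof.
elim: x => [a j|x1 IH1 x2 IH2] /=; first exact/tyeq_sym/tyeq_scal.
exact: tyeq_trans (tyeq_GPlus IH1 IH2) (tyeq_dist _ _ _).
Qed.

Lemma tweight_scale (K : comPzRingType) J c (x : tree K J) :
  tweight (tscale c x) = c * tweight x.
Proof. by elim: x => //= x1 -> x2 ->; rewrite mulrDr. Qed.

Lemma tall_scale (K : comPzRingType) J (ok : J -> Prop) c (x : tree K J) :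
  tall ok x -> tall ok (tscale c x).
Proof. by elim: x => //= x1 IH1 x2 IH2 [/IH1 ? /IH2 ?]. Qed.

Lemma tree_of_gsum (K : comPzRingType) J (ok : J -> Prop) n
    (a : 'I_n.+1 -> K) (j : 'I_n.+1 -> J) :
  (forall i, ok (j i)) ->
  exists x : tree K J,
    [/\ tall ok x, tweight x = \sum_i a i &
        forall h, teval h x = gsum (fun i => GScal (a i) (h (j i)))].
Proof.
elim: n a j => [|n IH] a j okj.
  by exists (Leaf (a ord0) (j ord0)); rewrite /= big_ord_recl big_ord0 addr0.
have [x [okx wx ex]] := IH (fun i => a (lift ord0 i)) (fun i => j (lift ord0 i))
  (fun i => okj _).
exists (Node (Leaf (a ord0) (j ord0)) x); split=> [||h] /=.
- by [].
- by rewrite wx [RHS]big_ord_recl.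
- by rewrite ex.
Qed.

Lemma gsum_of_tree (K : comPzRingType) J (ok : J -> Prop) (x : tree K J) :
  tall ok x ->
  exists n (a : 'I_n.+1 -> K) (j : 'I_n.+1 -> J),
    [/\ forall i, ok (j i), tweight x = \sum_i a i &
        forall h, tyeq (teval h x) (gsum (fun i => GScal (a i) (h (j i))))].
Proof.
elim: x => [a j okj|x1 IH1 x2 IH2 [/IH1 IH /IH2]] /=.
  exists 0%N, (fun=> a), (fun=> j); split=> [//||h]; last exact: tyeq_refl.
  by rewrite big_ord_recl big_ord0 addr0.
case: IH => n [a [j [okj wj ej]]] [m [b [k [okk wk ek]]]].
pose sel A (f : 'I_n.+1 -> A) (g : 'I_m.+1 -> A) (i : 'I_(n.+1 + m.+1)) :=
  match split i with inl i1 => f i1 | inr i2 => g i2 end.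
have sell A (f : 'I_n.+1 -> A) g i : sel A f g (lshift m.+1 i) = f i.
  by rewrite /sel (unsplitK (inl i)).
have selr A (f : 'I_n.+1 -> A) g i : sel A f g (rshift n.+1 i) = g i.
  by rewrite /sel (unsplitK (inr i)).
exists (n + m.+1)%N, (sel K a b), (sel J j k); split=> [i||h].
- by rewrite /sel; case: split.
- rewrite (@big_split_ord _ _ _ n.+1 m.+1) wj wk.
  by congr (_ + _); apply: eq_bigr => i _; rewrite ?sell ?selr.
- apply: tyeq_trans (tyeq_GPlus (ej h) (ek h)) _.
  apply: tyeq_trans (tyeq_sym (gsum_split _)).
  by apply: tyeq_GPlus; apply: gsum_eq => i; rewrite ?sell ?selr;
    apply: tyeq_refl.
Qed.

(** * Lifting linear combinations *)

(* [lrel ok f g R S]: for some linear combination [x] of indices,              *)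
(* [R = f x] and [S = g x]. All the rules of the type system that act on sums *)
(* of unit types have this shape.                                             *)
Definition lrel (K : comPzRingType) (J : Type) (ok : J -> Prop)
    (f : J -> utype K) (g : J -> gtype K) (R S : gtype K) : Prop :=
  exists x : tree K J,
    [/\ tall ok x, tyeq R (teval (fun j => GUnit (f j)) x)
      & tyeq S (teval g x)].

Inductive affine (K : comPzRingType) (Q : gtype K -> Prop) : gtype K -> Prop :=
| affine_in S S' : Q S -> tyeq S' S -> affine Q S'
| affine_step c S1 S2 S3 S :
    affine Q S1 -> affine Q S2 -> affine Q S3 ->
    tyeq S (GPlus S1 (GPlus (GScal c S2) (GScal (- c) S3))) -> affine Q S.

(* Computes [lrel] by recursion on its first argument. The combination [x]     *)
(* above a given [R] is not unique, because [f] need not be injective; two    *)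
(* choices differ by a combination of total weight 0 over each atom of [R],   *)
(* which is what the term [S2 - S3] of the scalar case accounts for.          *)
Fixpoint fiber (K : comPzRingType) (J : Type) (ok : J -> Prop)
    (f : J -> utype K) (g : J -> gtype K) (R : gtype K) (S : gtype K) : Prop :=
  match R with
  | GUnit V =>
      affine (fun S' => exists j,
                [/\ ok j, tyeq (GUnit (f j)) (GUnit V) & S' = g j]) S
  | GScal a R1 =>
      exists S1 S2 S3,
        [/\ fiber ok f g R1 S1, fiber ok f g R1 S2, fiber ok f g R1 S3
          & tyeq S (GPlus (GScal a S1) (GPlus S2 (GScal (- 1) S3)))]
  | GPlus R1 R2 =>
      exists S1 S2,
        [/\ fiber ok f g R1 S1, fiber ok f g R2 S2 & tyeq S (GPlus S1 S2)]
  | GVar _ => False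
  end.

Lemma affine_eq (K : comPzRingType) (Q : gtype K -> Prop) S S' :
  affine Q S -> tyeq S' S -> affine Q S'.
Proof.
case=> [{}S S0 QS e|c S1 S2 S3 S0 Q1 Q2 Q3 e] e'.
- exact: affine_in QS (tyeq_trans e' e).
- exact: affine_step Q1 Q2 Q3 (tyeq_trans e' e).
Qed.

Lemma affine_sub (K : comPzRingType) (Q Q' : gtype K -> Prop) S :
  (forall S, Q S -> Q' S) -> affine Q S -> affine Q' S.
Proof.
move=> QQ'; elim=> [{}S S0 QS e|c S1 S2 S3 S0 _ Q1 _ Q2 _ Q3 e].
- exact: affine_in (QQ' _ QS) e.
- exact: affine_step Q1 Q2 Q3 e.
Qed.

Section Fiber.

Variables (K : comPzRingType) (J : Type) (ok : J -> Prop).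
Variables (f : J -> utype K) (g : J -> gtype K).

Local Notation fib := (fiber ok f g).
Local Notation rl := (lrel ok f g).

Lemma fiber_eq R S S' : fib R S -> tyeq S' S -> fib R S'.
Proof.
case: R => [V|a R|R1 R2|n] //=.
- exact: affine_eq.
- by move=> [S1 [S2 [S3 [? ? ? e]]]] e'; exists S1, S2, S3; split=> //;
    apply: tyeq_trans e' e.
- by move=> [S1 [S2 [? ? e]]] e'; exists S1, S2; split=> //;
    apply: tyeq_trans e' e.
Qed.

Lemma fiber_affine R c S1 S2 S3 S :
  fib R S1 -> fib R S2 -> fib R S3 ->
  tyeq S (GPlus S1 (GPlus (GScal c S2) (GScal (- c) S3))) -> fib R S.
Proof.
elim: R S1 S2 S3 S => [V|a R IH|R1 IH1 R2 IH2|n] S1 S2 S3 S //=.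
- exact: affine_step.
- move=> [X1 [X2 [X3 [x1 x2 x3 ex]]]] [Y1 [Y2 [Y3 [y1 y2 y3 ey]]]].
  move=> [Z1 [Z2 [Z3 [z1 z2 z3 ez]]]] e.
  have P1 := IH _ _ _ _ x1 y1 z1 (tyeq_refl _).
  have P2 := IH _ _ _ _ x2 y2 z2 (tyeq_refl _).
  have P3 := IH _ _ _ _ x3 y3 z3 (tyeq_refl _).
  do 3!eexists; split; [exact: P1|exact: P2|exact: P3|].
  apply: tyeq_trans e _.
  apply: tyeq_trans (tyeq_GPlus ex (tyeq_GPlus (tyeq_GScal c ey)
    (tyeq_GScal (- c) ez))) _.
  tyring.
- move=> [X1 [X2 [x1 x2 ex]]] [Y1 [Y2 [y1 y2 ey]]] [Z1 [Z2 [z1 z2 ez]]] e.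
  have P1 := IH1 _ _ _ _ x1 y1 z1 (tyeq_refl _).
  have P2 := IH2 _ _ _ _ x2 y2 z2 (tyeq_refl _).
  do 2!eexists; split; [exact: P1|exact: P2|].
  apply: tyeq_trans e _.
  apply: tyeq_trans (tyeq_GPlus ex (tyeq_GPlus (tyeq_GScal c ey)
    (tyeq_GScal (- c) ez))) _.
  tyring.
Qed.

Lemma fiber_scal R a S1 S2 S3 S :
  fib R S1 -> fib R S2 -> fib R S3 ->
  tyeq S (GPlus (GScal a S1) (GPlus S2 (GScal (- 1) S3))) ->
  fib (GScal a R) S.
Proof. by move=> ? ? ? ?; exists S1, S2, S3. Qed.

Lemma fiber_one R S : fib (GScal 1 R) S <-> fib R S.
Proof.
split=> [[S1 [S2 [S3 [x1 x2 x3 e]]]]|x].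
  by apply: (fiber_affine x1 x2 x3 (c := 1)); apply: tyeq_trans e _; tyring.
by apply: (fiber_scal x x x); tyring.
Qed.

Lemma fiber_scal_scal a b R S :
  fib (GScal a (GScal b R)) S <-> fib (GScal (a * b) R) S.
Proof.
split=> [[S1 [S2 [S3 [x1 x2 x3 e]]]]|[S1 [S2 [S3 [x1 x2 x3 e]]]]].
- case: x1 => [X1 [X2 [X3 [x1 x2' x3' ex]]]].
  case: x2 => [Y1 [Y2 [Y3 [y1 y2 y3 ey]]]].
  case: x3 => [Z1 [Z2 [Z3 [z1 z2 z3 ez]]]].
  have P1 := fiber_affine x1 x2' x3' (tyeq_refl _) (c := a).
  have P2 := fiber_affine P1 y1 z1 (tyeq_refl _) (c := b).
  have P3 := fiber_affine P2 y2 y3 (tyeq_refl _) (c := 1).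
  have P4 := fiber_affine P3 z3 z2 (tyeq_refl _) (c := 1).
  apply: (fiber_scal x1 P4 x1).
  apply: tyeq_trans e _.
  apply: tyeq_trans (tyeq_GPlus (tyeq_GScal a ex)
    (tyeq_GPlus ey (tyeq_GScal (- 1) ez))) _.
  tyring.
- have P1 := fiber_scal x1 x1 x1 (tyeq_refl _) (a := b).
  have P2 := fiber_scal x1 x2 x3 (tyeq_refl _) (a := b).
  apply: (fiber_scal P1 P2 P1); apply: tyeq_trans e _; tyring.
Qed.

Lemma fiber_dist a R1 R2 S :
  fib (GPlus (GScal a R1) (GScal a R2)) S <-> fib (GScal a (GPlus R1 R2)) S.
Proof.
split.
- move=> [S1 [S2 [[X1 [X2 [X3 [x1 x2 x3 ex]]]] [Y1 [Y2 [Y3 [y1 y2 y3 ey]]]] e]]].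
  exists (GPlus X1 Y1), (GPlus X2 Y2), (GPlus X3 Y3); split.
  + by exists X1, Y1; split=> //; apply: tyeq_refl.
  + by exists X2, Y2; split=> //; apply: tyeq_refl.
  + by exists X3, Y3; split=> //; apply: tyeq_refl.
  + apply: tyeq_trans e _; apply: tyeq_trans (tyeq_GPlus ex ey) _; tyring.
- move=> [S1 [S2 [S3 [[X1 [Y1 [x1 y1 e1]]] [X2 [Y2 [x2 y2 e2]]]
    [X3 [Y3 [x3 y3 e3]]] e]]]].
  have Px := fiber_scal x1 x2 x3 (tyeq_refl _) (a := a).
  have Py := fiber_scal y1 y2 y3 (tyeq_refl _) (a := a).
  do 2!eexists; split; [exact: Px|exact: Py|].
  apply: tyeq_trans e _.
  apply: tyeq_trans (tyeq_GPlus (tyeq_GScal a e1)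
    (tyeq_GPlus e2 (tyeq_GScal (- 1) e3))) _.
  tyring.
Qed.

Lemma fiber_fact a b R S :
  fib (GPlus (GScal a R) (GScal b R)) S <-> fib (GScal (a + b) R) S.
Proof.
split.
- move=> [S1 [S2 [[X1 [X2 [X3 [x1 x2 x3 ex]]]] [Y1 [Y2 [Y3 [y1 y2 y3 ey]]]] e]]].
  have P1 := fiber_affine x1 y1 x1 (tyeq_refl _) (c := b).
  have P2 := fiber_affine P1 x2 x3 (tyeq_refl _) (c := 1).
  have P3 := fiber_affine P2 y2 y3 (tyeq_refl _) (c := 1).
  apply: (fiber_scal x1 P3 x1).
  apply: tyeq_trans e _; apply: tyeq_trans (tyeq_GPlus ex ey) _; tyring.
- move=> [S1 [S2 [S3 [x1 x2 x3 e]]]].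
  have P1 := fiber_scal x1 x2 x3 (tyeq_refl _) (a := a).
  have P2 := fiber_scal x1 x1 x1 (tyeq_refl _) (a := b).
  do 2!eexists; split; [exact: P1|exact: P2|].
  apply: tyeq_trans e _; tyring.
Qed.

Lemma fiber_unit V V' S :
  tyeq (GUnit V) (GUnit V') -> fib (GUnit V) S <-> fib (GUnit V') S.
Proof.
move=> e; split; apply: affine_sub => _ [j [okj ej ->]]; exists j; split=> //.
- exact: tyeq_trans ej e.
- exact: tyeq_trans ej (tyeq_sym e).
Qed.

Lemma fiber_tyeq R R' : tyeq R R' -> forall S, fib R S <-> fib R' S.
Proof.
elim=> {R R'}.
- exact: fiber_one.
- exact: fiber_scal_scal.
- exact: fiber_dist.
- exact: fiber_fact.
- move=> R1 R2 S; split=> [] [S1 [S2 [x1 x2 e]]]; exists S2, S1; split=> //;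
    exact: tyeq_trans e (tyeq_comm _ _).
- move=> R1 R2 R3 S; split.
  + move=> [S1 [X [x1 [S2 [S3 [x2 x3 e']]] e]]].
    exists (GPlus S1 S2), S3; split=> //.
      by exists S1, S2; split=> //; apply: tyeq_refl.
    apply: tyeq_trans e _.
    by apply: tyeq_trans (tyeq_GPlus (tyeq_refl _) e') _; apply: tyeq_assoc.
  + move=> [X [S3 [[S1 [S2 [x1 x2 e']]] x3 e]]].
    exists S1, (GPlus S2 S3); split=> //.
      by exists S2, S3; split=> //; apply: tyeq_refl.
    apply: tyeq_trans e _.
    apply: tyeq_trans (tyeq_GPlus e' (tyeq_refl _)) _.
    exact/tyeq_sym/tyeq_assoc.
- by [].
- by move=> R1 R2 _ IH S; rewrite IH.
- by move=> R1 R2 R3 _ IH1 _ IH2 S; rewrite IH1.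
- by move=> a R R' _ IH S; split=> [] [S1 [S2 [S3 [x1 x2 x3 e]]]];
    exists S1, S2, S3; split=> //; apply/IH.
- by move=> R1 R1' R2 R2' _ IH1 _ IH2 S; split=> [] [S1 [S2 [x1 x2 e]]];
    exists S1, S2; split=> //; [apply/IH1|apply/IH2|apply/IH1|apply/IH2].
- by move=> U U' T T' eU _ eT _ S; apply/fiber_unit/tyeq_UArr.
- by move=> k U U' eU _ S; apply/fiber_unit/tyeq_UAll.
Qed.

Lemma fiber_of_tree x :
  tall ok x -> fib (teval (fun j => GUnit (f j)) x) (teval g x).
Proof.
elim: x => [a j okj|x1 IH1 x2 IH2 [/IH1 ? /IH2 ?]].
  have P : fib (GUnit (f j)) (g j).
    by apply: affine_in (tyeq_refl _); exists j; split=> //; apply: tyeq_refl.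
  by apply: (fiber_scal P P P); rewrite /=; tyring.
by exists (teval g x1), (teval g x2); split=> //; apply: tyeq_refl.
Qed.

Lemma lrel_eq R S R' S' : rl R S -> tyeq R' R -> tyeq S' S -> rl R' S'.
Proof.
by move=> [x [okx eR eS]] e e'; exists x; split=> //;
  [apply: tyeq_trans e eR|apply: tyeq_trans e' eS].
Qed.

Lemma lrel_plus R1 S1 R2 S2 :
  rl R1 S1 -> rl R2 S2 -> rl (GPlus R1 R2) (GPlus S1 S2).
Proof.
by move=> [x [? ? ?]] [y [? ? ?]]; exists (Node x y); split=> //;
  apply: tyeq_GPlus.
Qed.

Lemma lrel_scal a R S : rl R S -> rl (GScal a R) (GScal a S).
Proof.
move=> [x [okx eR eS]]; exists (tscale a x); split; first exact: tall_scale.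
- exact: tyeq_trans (tyeq_GScal a eR) (tyeq_sym (teval_scale _ _ _)).
- exact: tyeq_trans (tyeq_GScal a eS) (tyeq_sym (teval_scale _ _ _)).
Qed.

Lemma lrel_leaf a j : ok j -> rl (GScal a (GUnit (f j))) (GScal a (g j)).
Proof. by exists (Leaf a j); split=> //; apply: tyeq_refl. Qed.

Lemma lrelP R S : rl R S <-> fib R S.
Proof.
split=> [[x [okx eR eS]]|].
  by apply/(fiber_tyeq eR); apply: fiber_eq eS; apply: fiber_of_tree.
elim: R S => [V|a R IH|R1 IH1 R2 IH2|n] S //=.
- elim=> {S} [_ S' [j [okj ej ->]] e|c S1 S2 S3 S _ r1 _ r2 _ r3 e].
    apply: lrel_eq (lrel_leaf 1 okj) _ _.
      by apply: tyeq_trans (tyeq_sym ej) _; apply/tyeq_sym/tyeq_one.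
    by apply: tyeq_trans e _; apply/tyeq_sym/tyeq_one.
  apply: lrel_eq (lrel_plus r1 (lrel_plus (lrel_scal c r2) (lrel_scal (- c) r3))) _ e.
  tyring.
- move=> [S1 [S2 [S3 [/IH r1 /IH r2 /IH r3 e]]]].
  apply: lrel_eq (lrel_plus (lrel_scal a r1) (lrel_plus r2 (lrel_scal (- 1) r3))) _ e.
  tyring.
- move=> [S1 [S2 [/IH1 r1 /IH2 r2 e]]].
  exact: lrel_eq (lrel_plus r1 r2) (tyeq_refl _) e.
Qed.

Lemma lrel_plus_inv R1 R2 S :
  rl (GPlus R1 R2) S ->
  exists S1 S2, [/\ rl R1 S1, rl R2 S2 & tyeq S (GPlus S1 S2)].
Proof.
by move=> /lrelP[S1 [S2 [/lrelP r1 /lrelP r2 e]]]; exists S1, S2.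
Qed.

Lemma lrel_scal_inv a R S :
  rl (GScal a R) S ->
  exists S1 S2 S3, [/\ rl R S1, rl R S2, rl R S3
    & tyeq S (GPlus (GScal a S1) (GPlus S2 (GScal (- 1) S3)))].
Proof.
by move=> /lrelP[S1 [S2 [S3 [/lrelP r1 /lrelP r2 /lrelP r3 e]]]]; exists S1, S2, S3.
Qed.

Lemma lrel_gsum n (a : 'I_n.+1 -> K) (j : 'I_n.+1 -> J) :
  (forall i, ok (j i)) ->
  rl (gsum (fun i => GScal (a i) (GUnit (f (j i)))))
     (gsum (fun i => GScal (a i) (g (j i)))).
Proof.
move=> okj; have [x [okx _ ex]] := tree_of_gsum a okj.
by exists x; rewrite !ex; split=> //; apply: tyeq_refl.
Qed.

Lemma lrel_gsum_inv R S :
  rl R S ->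
  exists n (a : 'I_n.+1 -> K) (j : 'I_n.+1 -> J),
    [/\ forall i, ok (j i),
        tyeq R (gsum (fun i => GScal (a i) (GUnit (f (j i)))))
      & tyeq S (gsum (fun i => GScal (a i) (g (j i))))].
Proof.
move=> [x [/gsum_of_tree[n [a [j [okj _ e]]]] eR eS]].
by exists n, a, j; split=> //; [apply: tyeq_trans eR (e (fun j => GUnit (f j)))
  |apply: tyeq_trans eS (e g)].
Qed.

End Fiber.

Definition comb (K : comPzRingType) (Q : gtype K -> Prop) (a : K)
    (T : gtype K) : Prop :=
  exists x : tree K (gtype K),
    [/\ tall Q x, tweight x = a & tyeq T (teval id x)].

Section Comb.

Variable K : comPzRingType.
Implicit Types (Q : gtype K -> Prop) (a b : K) (T R S : gtype K).

Lemma comb_ind Q (P : K -> gtype K -> Prop) :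
  (forall a T, Q T -> P a (GScal a T)) ->
  (forall a b T R, P a T -> P b R -> P (a + b) (GPlus T R)) ->
  (forall a T R, P a T -> tyeq R T -> P a R) ->
  forall a T, comb Q a T -> P a T.
Proof.
move=> Pl Pn Pe a T [x [Qx <- e]]; apply: Pe e => {T a}.
by elim: x Qx => [a T|x1 IH1 x2 IH2] /=; [apply: Pl|case=> /IH1 + /IH2; apply: Pn].
Qed.

Lemma comb_eq Q a T R : comb Q a T -> tyeq R T -> comb Q a R.
Proof. by move=> [x [? ? e]] e'; exists x; split=> //; apply: tyeq_trans e' e. Qed.

Lemma comb_leaf Q a T : Q T -> comb Q a (GScal a T).
Proof. by exists (Leaf a T); split=> //; apply: tyeq_refl. Qed.

Lemma comb_in Q T : Q T -> comb Q 1 T.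
Proof. by move=> /(comb_leaf 1)/comb_eq; apply; apply/tyeq_sym/tyeq_one. Qed.

Lemma comb_plus Q a b T R :
  comb Q a T -> comb Q b R -> comb Q (a + b) (GPlus T R).
Proof.
by move=> [x [? <- ?]] [y [? <- ?]]; exists (Node x y); split=> //;
  apply: tyeq_GPlus.
Qed.

Lemma comb_scal Q a b T : comb Q b T -> comb Q (a * b) (GScal a T).
Proof.
move=> [x [Qx <- e]]; exists (tscale a x); split.
- exact: tall_scale.
- exact: tweight_scale.
- exact: tyeq_trans (tyeq_GScal a e) (tyeq_sym (teval_scale _ _ _)).
Qed.

Lemma comb_gsum Q n (b : 'I_n.+1 -> K) (T : 'I_n.+1 -> gtype K) :
  (forall i, comb Q (b i) (T i)) -> comb Q (\sum_i b i) (gsum T).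
Proof.
elim: n b T => [|n IH] b T QT; rewrite big_ord_recl /=.
  by rewrite big_ord0 addr0.
by apply: comb_plus => //; apply: IH.
Qed.

Lemma comb_bind Q b a T : comb (comb Q b) a T -> comb Q (a * b) T.
Proof.
elim/comb_ind=> [{}a {}T|a1 a2 T1 T2|{}a {}T R].
- exact: comb_scal.
- by rewrite mulrDl; apply: comb_plus.
- exact: comb_eq.
Qed.

Lemma comb_sub Q Q' a T : (forall T, Q T -> Q' T) -> comb Q a T -> comb Q' a T.
Proof.
move=> QQ'; elim/comb_ind=> [{}a {}T /QQ'|a1 a2 T1 T2|{}a {}T R].
- exact: comb_leaf.
- exact: comb_plus.
- exact: comb_eq.
Qed.

Lemma comb_lrel J (ok : J -> Prop) (f : J -> utype K) g Q a R S :
  comb Q a R -> lrel ok f g R S ->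
  comb (fun S' => exists2 R', Q R' & lrel ok f g R' S') a S.
Proof.
move=> QR; elim/comb_ind: QR S => {a R}
  [a R QR|a b R1 R2 IH1 IH2|a R R' IH e] S.
- move=> /lrel_scal_inv[S1 [S2 [S3 [r1 r2 r3 e]]]].
  apply: comb_eq e; rewrite -[a]addr0 -[0](subrr 1).
  apply: comb_plus; first by rewrite subrr addr0; apply: comb_leaf; exists R.
  by apply: comb_plus; [apply: comb_in|apply: comb_leaf]; exists R.
- move=> /lrel_plus_inv[S1 [S2 [/IH1 r1 /IH2 r2 e]]].
  by apply: comb_eq e; apply: comb_plus.
- by move=> r; apply: IH; apply: lrel_eq r (tyeq_sym e) (tyeq_refl _).
Qed.

End Comb.

(** * Substitution in types *)

Scheme gtype_mut := Induction for gtype Sort Prop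
  with utype_mut := Induction for utype Sort Prop.
Combined Scheme types_ind from gtype_mut, utype_mut.

Section TypeSubst.

Variable K : comPzRingType.
Implicit Types (ru rg : nat -> nat) (su : nat -> utype K) (sg : nat -> gtype K).

Lemma upu_ren k ru :
  upu k (fun n => UVar (ru n)) = (fun n => UVar (upren_at k KUnit ru n)) :>
    (nat -> utype K).
Proof. by apply: functional_extensionality; case: k => -[]. Qed.

Lemma upg_ren k rg :
  upg k (fun n => GVar (rg n)) = (fun n => GVar (upren_at k KGen rg n)) :>
    (nat -> gtype K).
Proof. by apply: functional_extensionality; case: k => -[]. Qed.

Lemma ren_subst :
  (forall (T : gtype K) ru rg,
     gren ru rg T = gsubst (fun n => UVar (ru n)) (fun n => GVar (rg n)) T) /\
  (forall (U : utype K) ru rg,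
     uren ru rg U = usubst (fun n => UVar (ru n)) (fun n => GVar (rg n)) U).
Proof.
apply: (types_ind (K := K)) => //=.
- by move=> U IH ru rg; rewrite IH.
- by move=> a T IH ru rg; rewrite IH.
- by move=> T IHT R IHR ru rg; rewrite IHT IHR.
- by move=> U IHU T IHT ru rg; rewrite IHT IHU.
- by move=> k U IH ru rg; rewrite IH upu_ren upg_ren.
Qed.

Lemma upu_upren k su ru :
  (fun n => upu k su (upren_at k KUnit ru n)) = upu k (fun n => su (ru n)).
Proof. by apply: functional_extensionality; case: k => -[]. Qed.

Lemma upg_upren k sg rg :
  (fun n => upg k sg (upren_at k KGen rg n)) = upg k (fun n => sg (rg n)).
Proof. by apply: functional_extensionality; case: k => -[]. Qed.

Lemma subst_ren :
  (forall (T : gtype K) su sg ru rg, gsubst su sg (gren ru rg T) =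
     gsubst (fun n => su (ru n)) (fun n => sg (rg n)) T) /\
  (forall (U : utype K) su sg ru rg, usubst su sg (uren ru rg U) =
     usubst (fun n => su (ru n)) (fun n => sg (rg n)) U).
Proof.
apply: (types_ind (K := K)) => //=.
- by move=> U IH *; rewrite IH.
- by move=> a T IH *; rewrite IH.
- by move=> T IHT R IHR *; rewrite IHT IHR.
- by move=> U IHU T IHT *; rewrite IHT IHU.
- by move=> k U IH *; rewrite IH upu_upren upg_upren.
Qed.

Definition gsubst_gren := proj1 subst_ren.
Definition usubst_uren := proj2 subst_ren.

Lemma ren_upu k su ru rg :
  (fun n => uren (upren_at k KUnit ru) (upren_at k KGen rg) (upu k su n)) =
  upu k (fun n => uren ru rg (su n)).
Proof.
apply: functional_extensionality; case: k => -[|n] //=;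
  by rewrite /ushift [LHS](proj2 ren_subst) [RHS](proj2 ren_subst) !usubst_uren.
Qed.

Lemma ren_upg k sg ru rg :
  (fun n => gren (upren_at k KUnit ru) (upren_at k KGen rg) (upg k sg n)) =
  upg k (fun n => gren ru rg (sg n)).
Proof.
apply: functional_extensionality; case: k => -[|n] //=;
  by rewrite /gshift [LHS](proj1 ren_subst) [RHS](proj1 ren_subst) !gsubst_gren.
Qed.

Lemma ren_of_subst :
  (forall (T : gtype K) su sg ru rg, gren ru rg (gsubst su sg T) =
     gsubst (fun n => uren ru rg (su n)) (fun n => gren ru rg (sg n)) T) /\
  (forall (U : utype K) su sg ru rg, uren ru rg (usubst su sg U) =
     usubst (fun n => uren ru rg (su n)) (fun n => gren ru rg (sg n)) U).
Proof.
apply: (types_ind (K := K)) => //=.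
- by move=> U IH *; rewrite IH.
- by move=> a T IH *; rewrite IH.
- by move=> T IHT R IHR *; rewrite IHT IHR.
- by move=> U IHU T IHT *; rewrite IHT IHU.
- by move=> k U IH *; rewrite IH ren_upu ren_upg.
Qed.

Lemma subst_ushift k su sg (U : utype K) :
  usubst (upu k su) (upg k sg) (ushift k U) = ushift k (usubst su sg U).
Proof.
rewrite /ushift usubst_uren (proj2 ren_of_subst).
by congr usubst; case: k.
Qed.

Lemma subst_gshift k su sg (T : gtype K) :
  gsubst (upu k su) (upg k sg) (gshift k T) = gshift k (gsubst su sg T).
Proof.
rewrite /gshift gsubst_gren (proj1 ren_of_subst).
by congr gsubst; case: k.
Qed.

Lemma upu_comp k su sg su' :
  (fun n => usubst (upu k su) (upg k sg) (upu k su' n)) =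
  upu k (fun n => usubst su sg (su' n)).
Proof.
by apply: functional_extensionality; case: k => -[|n] //=;
  rewrite -subst_ushift.
Qed.

Lemma upg_comp k su sg sg' :
  (fun n => gsubst (upu k su) (upg k sg) (upg k sg' n)) =
  upg k (fun n => gsubst su sg (sg' n)).
Proof.
by apply: functional_extensionality; case: k => -[|n] //=;
  rewrite -subst_gshift.
Qed.

Lemma subst_comp :
  (forall (T : gtype K) su sg su' sg', gsubst su sg (gsubst su' sg' T) =
     gsubst (fun n => usubst su sg (su' n)) (fun n => gsubst su sg (sg' n)) T) /\
  (forall (U : utype K) su sg su' sg', usubst su sg (usubst su' sg' U) =
     usubst (fun n => usubst su sg (su' n)) (fun n => gsubst su sg (sg' n)) U).
Proof.
apply: (types_ind (K := K)) => //=.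
- by move=> U IH *; rewrite IH.
- by move=> a T IH *; rewrite IH.
- by move=> T IHT R IHR *; rewrite IHT IHR.
- by move=> U IHU T IHT *; rewrite IHT IHU.
- by move=> k U IH *; rewrite IH upu_comp upg_comp.
Qed.

Lemma subst_id :
  (forall T : gtype K, gsubst UVar GVar T = T) /\
  (forall U : utype K, usubst UVar GVar U = U).
Proof.
have eu k : upu k UVar = UVar :> (nat -> utype K).
  by rewrite (upu_ren k id); apply: functional_extensionality; case: k => -[].
have eg k : upg k GVar = GVar :> (nat -> gtype K).
  by rewrite (upg_ren k id); apply: functional_extensionality; case: k => -[].
apply: (types_ind (K := K)) => //=.
- by move=> U ->.
- by move=> a T ->.
- by move=> T -> R ->.
- by move=> U -> T ->.
- by move=> k U IH; rewrite eu eg IH.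
Qed.

Lemma gsubst_gsum su sg n (F : 'I_n.+1 -> gtype K) :
  gsubst su sg (gsum F) = gsum (fun i => gsubst su sg (F i)).
Proof. by elim: n F => //= n IH F; rewrite IH. Qed.

Lemma gsubst_tyeq su sg (T R : gtype K) :
  tyeq T R -> tyeq (gsubst su sg T) (gsubst su sg R).
Proof.
move=> e; elim: e su sg => {T R} /=; try by move=> *; constructor.
by move=> T R Q _ IH1 _ IH2 *; apply: tyeq_trans (IH1 _ _) (IH2 _ _).
Qed.

Definition subst_targ su sg (A : targ K) : targ K :=
  match A with
  | AUnit U => AUnit (usubst su sg U)
  | AGen T => AGen (gsubst su sg T)
  end.

Lemma kind_of_subst_targ su sg A : kind_of (subst_targ su sg A) = kind_of A.
Proof. by case: A. Qed.

Definition upsu (ks : seq kind) su := foldl (fun s k => upu k s) su ks.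
Definition upsg (ks : seq kind) sg := foldl (fun s k => upg k s) sg ks.

Lemma usubst_foralls su sg ks U :
  usubst su sg (foralls ks U) = foralls ks (usubst (upsu ks su) (upsg ks sg) U).
Proof. by elim: ks su sg => //= k ks IH su sg; rewrite IH. Qed.

Lemma inst_u_rcons (As : seq (targ K)) A :
  inst_u (rcons As A) = if A is AUnit V then scons V (inst_u As) else inst_u As.
Proof. by rewrite /inst_u foldl_rcons. Qed.

Lemma inst_g_rcons (As : seq (targ K)) A :
  inst_g (rcons As A) = if A is AGen T then scons T (inst_g As) else inst_g As.
Proof. by rewrite /inst_g foldl_rcons. Qed.

Lemma uinst_ushift (As : seq (targ K)) A U :
  uinst (rcons As A) (ushift (kind_of A) U) = uinst As U.
Proof.
rewrite /uinst /ushift usubst_uren inst_u_rcons inst_g_rcons.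
by case: A.
Qed.

Lemma ginst_gshift (As : seq (targ K)) A T :
  ginst (rcons As A) (gshift (kind_of A) T) = ginst As T.
Proof.
rewrite /ginst /gshift gsubst_gren inst_u_rcons inst_g_rcons.
by case: A.
Qed.

Lemma inst_ups su sg (As : seq (targ K)) :
  let As' := map (subst_targ su sg) As in
  let ks := map (@kind_of K) As in
  (forall n, uinst As' (upsu ks su n) = usubst su sg (inst_u As n)) /\
  (forall n, ginst As' (upsg ks sg n) = gsubst su sg (inst_g As n)).
Proof.
elim/last_ind: As => [|As A [IHu IHg]] /=.
  by split=> n; rewrite /uinst /ginst /inst_u /inst_g /= ?(proj1 subst_id) ?(proj2 subst_id).
rewrite !map_rcons /upsu /upsg !foldl_rcons -/(upsu _ su) -/(upsg _ sg).
rewrite inst_u_rcons inst_g_rcons.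
have eu V : uinst (rcons (map (subst_targ su sg) As) (subst_targ su sg A))
    (ushift (kind_of A) V) = uinst (map (subst_targ su sg) As) V.
  by rewrite -(kind_of_subst_targ su sg) uinst_ushift.
have eg V : ginst (rcons (map (subst_targ su sg) As) (subst_targ su sg A))
    (gshift (kind_of A) V) = ginst (map (subst_targ su sg) As) V.
  by rewrite -(kind_of_subst_targ su sg) ginst_gshift.
case: A eu eg => [V|V] /= eu eg; split=> -[|n] /=;
  rewrite ?eu ?eg ?IHu ?IHg //.
- by rewrite /uinst /= inst_u_rcons.
- by rewrite /ginst /= inst_g_rcons.
Qed.

Lemma usubst_uinst su sg (As : seq (targ K)) U :
  usubst su sg (uinst As U) =
  uinst (map (subst_targ su sg) As)
    (usubst (upsu (map (@kind_of K) As) su) (upsg (map (@kind_of K) As) sg) U).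
Proof.
have [eu eg] := inst_ups su sg As.
rewrite /uinst !(proj2 subst_comp).
by congr usubst; apply: functional_extensionality => n; rewrite -?eu -?eg.
Qed.

Lemma gsubst_ginst su sg (As : seq (targ K)) T :
  gsubst su sg (ginst As T) =
  ginst (map (subst_targ su sg) As)
    (gsubst (upsu (map (@kind_of K) As) su) (upsg (map (@kind_of K) As) sg) T).
Proof.
have [eu eg] := inst_ups su sg As.
rewrite /ginst !(proj1 subst_comp).
by congr gsubst; apply: functional_extensionality => n; rewrite -?eu -?eg.
Qed.

Definition ushifts (ks : seq kind) (U : utype K) : utype K :=
  foldl (fun V k => ushift k V) U ks.

Lemma uinst_ushifts (As : seq (targ K)) U :
  uinst As (ushifts (map (@kind_of K) As) U) = U.
Proof.
elim/last_ind: As => [|As A IH]; first exact: (proj2 subst_id).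
by rewrite map_rcons /ushifts foldl_rcons uinst_ushift.
Qed.

End TypeSubst.

(** * Substitution in typing derivations *)

Section Typing.

Variable K : comPzRingType.
Implicit Types (G D : ctx K) (t r u : term K) (T R S : gtype K) (U V : utype K).

Lemma typed_subst_types su sg G t T :
  typed G t T -> typed (map (usubst su sg) G) t (gsubst su sg T).
Proof.
move=> ty; elim: ty su sg => {G t T}.
- by move=> G x U e su sg; apply: ty_ax; rewrite onth_map e.
- by move=> G t T R _ IH e su sg; apply: ty_equiv (IH _ _) (gsubst_tyeq _ _ e).
- by move=> G t U T _ IH su sg; apply: ty_arrI (IH _ _).
- move=> G t r n m a b Xs U T As kAs _ IHt _ IHr su sg.
  have {}IHt := IHt su sg; have {}IHr := IHr su sg.
  rewrite gsubst_gsum /= in IHt; rewrite gsubst_gsum /= in IHr.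
  pose As' j := map (subst_targ su sg) (As j).
  have kAs' j : map (@kind_of K) (As' j) = Xs.
    by rewrite -(kAs j) -map_comp; apply: eq_map => A; apply: kind_of_subst_targ.
  rewrite gsubst_gsum.
  have -> : (fun i => gsubst su sg (gsum (fun j =>
        GScal (a i * b j) (ginst (As j) (T i))))) =
      (fun i => gsum (fun j => GScal (a i * b j)
        (ginst (As' j) (gsubst (upsu Xs su) (upsg Xs sg) (T i))))).
    apply: functional_extensionality => i; rewrite gsubst_gsum /=.
    by congr gsum; apply: functional_extensionality => j;
      rewrite gsubst_ginst kAs.
  apply: (ty_arrE (U := usubst (upsu Xs su) (upsg Xs sg) U) kAs').
  + congr (typed _ _ (gsum _)): IHt.
    by apply: functional_extensionality => i; rewrite usubst_foralls.
  + congr (typed _ _ (gsum _)): IHr.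
    by apply: functional_extensionality => j; rewrite usubst_uinst kAs.
- move=> G t n a k U _ IH su sg; rewrite gsubst_gsum /=.
  apply: ty_forallI.
  have := IH (upu k su) (upg k sg); rewrite gsubst_gsum /=.
  congr (typed _ _ _); rewrite -!map_comp; apply: eq_map => V /=.
  exact: subst_ushift.
- move=> G t n a k U A kA _ IH su sg.
  have {}IH := IH su sg; rewrite gsubst_gsum /= in IH.
  rewrite gsubst_gsum /=.
  have -> : (fun i => GScal (a i) (GUnit (usubst su sg (uinst [:: A] (U i))))) =
      (fun i => GScal (a i) (GUnit (uinst [:: subst_targ su sg A]
        (usubst (upu k su) (upg k sg) (U i))))).
    by apply: functional_extensionality => i; rewrite usubst_uinst /= kA.
  by apply: ty_forallE IH; rewrite kind_of_subst_targ.
- by move=> G t r T R _ IHt _ IHr su sg; apply: ty_plusI.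
- by move=> G t T _ IH su sg; apply: ty_oneE (IH _ _).
- by move=> G t n a T _ IH su sg; rewrite gsubst_gsum /=; apply: ty_S.
Qed.

Lemma ushiftE k U :
  ushift k U =
  usubst (fun n => UVar (shift_at k KUnit n)) (fun n => GVar (shift_at k KGen n)) U.
Proof. exact: (proj2 (ren_subst K)). Qed.

Lemma typed_ushift k G t U :
  typed G t (GUnit U) -> typed (map (ushift k) G) t (GUnit (ushift k U)).
Proof.
rewrite ushiftE (eq_map (ushiftE k)) => ty; exact: typed_subst_types ty.
Qed.

Lemma typed_ren (s : nat -> nat) G D t T :
  (forall x U, onth G x = Some U -> onth D (s x) = Some U) ->
  typed G t T -> typed D (ren s t) T.
Proof.
move=> sGD ty; elim: ty s D sGD => {G t T}.
- by move=> G x U e s D sGD; apply: ty_ax; apply: sGD.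
- by move=> G t T R _ IH e s D sGD; apply: ty_equiv (IH _ _ sGD) e.
- move=> G t U T _ IH s D sGD; apply: ty_arrI; apply: IH => -[|x] V //=.
  exact: sGD.
- by move=> G t r n m a b Xs U T As kAs _ IHt _ IHr s D sGD;
    apply: ty_arrE kAs (IHt _ _ sGD) (IHr _ _ sGD).
- move=> G t n a k U _ IH s D sGD; apply: ty_forallI; apply: IH => x V.
  by rewrite !onth_map; case e: (onth G x) => [W|] //= [<-]; rewrite (sGD _ _ e).
- by move=> G t n a k U A kA _ IH s D sGD; apply: ty_forallE kA (IH _ _ sGD).
- by move=> G t r T R _ IHt _ IHr s D sGD;
    apply: ty_plusI (IHt _ _ sGD) (IHr _ _ sGD).
- by move=> G t T _ IH s D sGD; apply: ty_oneE (IH _ _ sGD).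
- by move=> G t n a T _ IH s D sGD; apply: ty_S => i; apply: IH.
Qed.

Lemma typed_subst (s : nat -> term K) G D t T :
  (forall x U, onth G x = Some U -> typed D (s x) (GUnit U)) ->
  typed G t T -> typed D (subst s t) T.
Proof.
move=> sGD ty; elim: ty s D sGD => {G t T}.
- by move=> G x U e s D sGD; apply: sGD.
- by move=> G t T R _ IH e s D sGD; apply: ty_equiv (IH _ _ sGD) e.
- move=> G t U T _ IH s D sGD; apply: ty_arrI; apply: IH => -[|x] V /=.
    by move=> [<-]; apply: ty_ax.
  by move=> /sGD; apply: typed_ren.
- by move=> G t r n m a b Xs U T As kAs _ IHt _ IHr s D sGD;
    apply: ty_arrE kAs (IHt _ _ sGD) (IHr _ _ sGD).
- move=> G t n a k U _ IH s D sGD; apply: ty_forallI; apply: IH => x V.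
  rewrite !onth_map; case e: (onth G x) => [W|] //= [<-].
  exact: typed_ushift (sGD _ _ e).
- by move=> G t n a k U A kA _ IH s D sGD; apply: ty_forallE kA (IH _ _ sGD).
- by move=> G t r T R _ IHt _ IHr s D sGD;
    apply: ty_plusI (IHt _ _ sGD) (IHr _ _ sGD).
- by move=> G t T _ IH s D sGD; apply: ty_oneE (IH _ _ sGD).
- by move=> G t n a T _ IH s D sGD; apply: ty_S => i; apply: IH.
Qed.

Lemma subst_Var t : subst Var t = t.
Proof.
have upV : up Var = Var :> (nat -> term K).
  by apply: functional_extensionality; case.
by elim: t => //= [t|t IHt r IHr|a t|t IHt r IHr];
  rewrite ?upV ?IHt ?IHr // => ->.
Qed.

Lemma typed_ctx_eq U U' G t T :
  tyeq (GUnit U) (GUnit U') -> typed (U :: G) t T -> typed (U' :: G) t T.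
Proof.
move=> e ty; rewrite -(subst_Var t); apply: typed_subst ty => -[|x] V /=.
  by move=> [<-]; apply: ty_equiv e; apply: ty_ax.
by move=> ?; apply: ty_ax.
Qed.

(** * Generation lemmas *)

Lemma typed_affine G t n (a : 'I_n.+1 -> K) (T : 'I_n.+1 -> gtype K) :
  \sum_i a i = 1 -> (forall i, typed G t (T i)) ->
  typed G t (gsum (fun i => GScal (a i) (T i))).
Proof. by move=> a1 tT; apply: ty_oneE; rewrite -a1; apply: ty_S. Qed.

Lemma lrel_forallI k n (a : 'I_n.+1 -> K) (U : 'I_n.+1 -> utype K) :
  lrel (fun=> True) id (fun U => GUnit (UAll k U))
    (gsum (fun i => GScal (a i) (GUnit (U i))))
    (gsum (fun i => GScal (a i) (GUnit (UAll k (U i))))).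
Proof. exact: lrel_gsum. Qed.

Lemma lrel_forallE A n (a : 'I_n.+1 -> K) (U : 'I_n.+1 -> utype K) :
  lrel (fun=> True) (UAll (kind_of A)) (fun U => GUnit (uinst [:: A] U))
    (gsum (fun i => GScal (a i) (GUnit (UAll (kind_of A) (U i)))))
    (gsum (fun i => GScal (a i) (GUnit (uinst [:: A] (U i))))).
Proof. exact: lrel_gsum. Qed.

Lemma typed_forallI_lrel k G t R S :
  typed (map (ushift k) G) t R ->
  lrel (fun=> True) id (fun U => GUnit (UAll k U)) R S -> typed G t S.
Proof.
move=> tR /lrel_gsum_inv[n [a [U [_ eR eS]]]].
by apply: ty_equiv eS; apply: ty_forallI; apply: ty_equiv tR (tyeq_sym eR).
Qed.

Lemma typed_forallE_lrel A G t R S :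
  typed G t R ->
  lrel (fun=> True) (UAll (kind_of A)) (fun U => GUnit (uinst [:: A] U)) R S ->
  typed G t S.
Proof.
move=> tR /lrel_gsum_inv[n [a [U [_ eR eS]]]].
apply: ty_equiv eS; apply: (ty_forallE (k := kind_of A)) => //.
exact: ty_equiv tR (tyeq_sym eR).
Qed.

Lemma typed_app_lrel_l G t r m (b : 'I_m.+1 -> K) Xs U As R S :
  (forall j, map (@kind_of K) (As j) = Xs) ->
  typed G t R ->
  lrel (fun=> True) (fun T => foralls Xs (UArr U T))
    (fun T => gsum (fun j => GScal (b j) (ginst (As j) T))) R S ->
  typed G r (gsum (fun j => GScal (b j) (GUnit (uinst (As j) U)))) ->
  typed G (App t r) S.
Proof.
move=> kAs tR /lrel_gsum_inv[n [a [T [_ eR eS]]]] tr.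
have tt := ty_equiv tR (tyeq_sym eR).
apply: ty_equiv (ty_arrE kAs tt tr) _.
apply: tyeq_trans eS _; apply: gsum_eq => i.
apply: tyeq_trans (gsum_scal _ _) _; apply: gsum_eq => j.
exact: tyeq_scal.
Qed.

Lemma typed_app_lrel_r G t r n (a : 'I_n.+1 -> K) Xs U
    (T : 'I_n.+1 -> gtype K) R S :
  typed G t (gsum (fun i => GScal (a i) (GUnit (foralls Xs (UArr U (T i)))))) ->
  typed G r R ->
  lrel (fun As => map (@kind_of K) As = Xs) (fun As => uinst As U)
    (fun As => gsum (fun i => GScal (a i) (ginst As (T i)))) R S ->
  typed G (App t r) S.
Proof.
move=> tt tR /lrel_gsum_inv[m [b [As [kAs eR eS]]]].
have tr := ty_equiv tR (tyeq_sym eR).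
apply: ty_equiv (ty_arrE kAs tt tr) _.
apply: tyeq_trans eS _; apply: tyeq_trans (tyeq_sym (gsum_exchange _)).
apply: gsum_eq => j; apply: tyeq_trans (gsum_scal _ _) _; apply: gsum_eq => i.
by rewrite mulrC; apply: tyeq_scal.
Qed.

Inductive intro_typed : ctx K -> term K -> gtype K -> Prop :=
| intro_ax G x U : onth G x = Some U -> intro_typed G (Var x) (GUnit U)
| intro_lam G t U T :
    typed (U :: G) t T -> intro_typed G (Lam t) (GUnit (UArr U T))
| intro_app G t r n m (a : 'I_n.+1 -> K) (b : 'I_m.+1 -> K) Xs U
    (T : 'I_n.+1 -> gtype K) (As : 'I_m.+1 -> seq (targ K)) :
    (forall j, map (@kind_of K) (As j) = Xs) ->
    typed G t (gsum (fun i => GScal (a i) (GUnit (foralls Xs (UArr U (T i)))))) ->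
    typed G r (gsum (fun j => GScal (b j) (GUnit (uinst (As j) U)))) ->
    intro_typed G (App t r)
      (gsum (fun i => gsum (fun j => GScal (a i * b j) (ginst (As j) (T i)))))
| intro_plus G t r T R :
    typed G t T -> typed G r R -> intro_typed G (Plus t r) (GPlus T R)
| intro_scal G a t T : comb (typed G t) a T -> intro_typed G (Scal a t) T.

(* Rule [ty_oneE] makes a derivation for [t] pass through [1 . t],            *)
(* [1 . (1 . t)], ..., whose types are affine combinations of types of [t].   *)
Lemma typed_generation t (P : ctx K -> gtype K -> Prop) :
  (forall G T R, P G T -> tyeq R T -> P G R) ->
  (forall G k n (a : 'I_n.+1 -> K) (U : 'I_n.+1 -> utype K),
     P (map (ushift k) G) (gsum (fun i => GScal (a i) (GUnit (U i)))) ->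
     P G (gsum (fun i => GScal (a i) (GUnit (UAll k (U i)))))) ->
  (forall G A n (a : 'I_n.+1 -> K) (U : 'I_n.+1 -> utype K),
     P G (gsum (fun i => GScal (a i) (GUnit (UAll (kind_of A) (U i))))) ->
     P G (gsum (fun i => GScal (a i) (GUnit (uinst [:: A] (U i)))))) ->
  (forall G n (a : 'I_n.+1 -> K) (T : 'I_n.+1 -> gtype K),
     \sum_i a i = 1 -> (forall i, P G (T i)) ->
     P G (gsum (fun i => GScal (a i) (T i)))) ->
  (forall G T, intro_typed G t T -> P G T) ->
  forall G T, typed G t T -> P G T.
Proof.
move=> Peq PI PE Paff Pin G T ty.
suff H s : typed G s T -> forall n, s = iter n (Scal 1) t -> P G T.
  exact: (H t ty 0%N).
move=> {}ty; elim: ty => {G T s}.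
- by move=> G x U e [|n] // eq; apply: Pin; rewrite -[t]eq; apply: intro_ax.
- by move=> G s T R _ IH e n eq; apply: Peq (IH n eq) e.
- by move=> G s U T ty _ [|n] // eq; apply: Pin; rewrite -[t]eq; apply: intro_lam.
- move=> G s r n m a b Xs U T As kAs ts _ tr _ [|p] // eq; apply: Pin.
  by rewrite -[t]eq; apply: intro_app kAs ts tr.
- by move=> G s n a k U _ IH p eq; apply: PI; apply: IH eq.
- by move=> G s n a k U A <- _ IH p eq; apply: PE; apply: IH eq.
- by move=> G s r T R ts _ tr _ [|p] // eq; apply: Pin; rewrite -[t]eq;
    apply: intro_plus.
- by move=> G s T _ IH n eq; apply: (IH n.+1); rewrite eq.
- move=> G s n a T ts IH [|p] eq.
    apply: Pin; rewrite -[t]eq; apply: intro_scal; apply: comb_gsum => i.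
    exact: comb_leaf.
  by case: eq => a1 es; apply: Paff => // i; apply: IH es.
Qed.

Lemma typed_transfer t t' :
  (forall G T, intro_typed G t T -> typed G t' T) ->
  forall G T, typed G t T -> typed G t' T.
Proof.
move=> H; apply: typed_generation H.
- by move=> G T R tT; apply: ty_equiv tT.
- by move=> G k n a U; apply: ty_forallI.
- by move=> G A n a U; apply: ty_forallE.
- by move=> G n a T; apply: typed_affine.
Qed.

Lemma typed_scal_comb G a t T : comb (typed G t) a T -> typed G (Scal a t) T.
Proof.
move=> [x [/gsum_of_tree[n [b [R [tR wx ex]]]] <- e]].
by apply: ty_equiv (tyeq_trans e (ex id)); rewrite wx; apply: ty_S.
Qed.

Lemma typed_scalE G a t T : typed G (Scal a t) T -> comb (typed G t) a T.
Proof.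
move: G T; apply: typed_generation.
- by move=> G T R; apply: comb_eq.
- move=> G k n b U /comb_lrel/(_ (lrel_forallI k b U)).
  by apply: comb_sub => S [R]; apply: typed_forallI_lrel.
- move=> G A n b U /comb_lrel/(_ (lrel_forallE A b U)).
  by apply: comb_sub => S [R]; apply: typed_forallE_lrel.
- move=> G n b T b1 tT.
  have -> : a = \sum_i b i * a by rewrite -mulr_suml b1 mul1r.
  by apply: comb_gsum => i; apply: comb_scal.
- by move=> G T H; inversion H.
Qed.

Lemma typed_plusE G t r T :
  typed G (Plus t r) T ->
  exists T1 T2, [/\ typed G t T1, typed G r T2 & tyeq T (GPlus T1 T2)].
Proof.
move: G T; apply: (typed_generation (t := Plus t r)).
- move=> G T R [T1 [T2 [t1 t2 e]]] e'; exists T1, T2; split=> //.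
  exact: tyeq_trans e' e.
- move=> G k n b U [T1 [T2 [t1 t2 e]]].
  have := lrel_forallI k b U.
  move=> /lrel_eq/(_ (tyeq_sym e) (tyeq_refl _))/lrel_plus_inv[S1 [S2 [r1 r2 e']]].
  by exists S1, S2; split=> //; [apply: typed_forallI_lrel t1 r1
    |apply: typed_forallI_lrel t2 r2].
- move=> G A n b U [T1 [T2 [t1 t2 e]]].
  have := lrel_forallE A b U.
  move=> /lrel_eq/(_ (tyeq_sym e) (tyeq_refl _))/lrel_plus_inv[S1 [S2 [r1 r2 e']]].
  by exists S1, S2; split=> //; [apply: typed_forallE_lrel t1 r1
    |apply: typed_forallE_lrel t2 r2].
- move=> G n a T a1.
  move=> /fin_all_exists[T1 /fin_all_exists[T2 H]].
  exists (gsum (fun i => GScal (a i) (T1 i))), (gsum (fun i => GScal (a i) (T2 i))).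
  split; [by apply: typed_affine => // i; case: (H i)..|].
  apply: tyeq_trans (gsum_plus _ _); apply: gsum_eq => i.
  case: (H i) => _ _ e; apply: tyeq_trans (tyeq_GScal _ e) _.
  exact/tyeq_sym/tyeq_dist.
- by move=> G T H; inversion H; subst; exists T0, R; split=> //; apply: tyeq_refl.
Qed.

Fixpoint gweight (T : gtype K) : K :=
  match T with
  | GUnit _ | GVar _ => 1
  | GScal a T1 => a * gweight T1
  | GPlus T1 T2 => gweight T1 + gweight T2
  end.

Lemma gweight_tyeq T R : tyeq T R -> gweight T = gweight R.
Proof.
elim=> {T R} //=; try by move=> *; ring.
- by move=> T R Q _ -> _ ->.
- by move=> a T R _ ->.
- by move=> T R T' R' _ -> _ ->.
Qed.

Lemma gweight_gsum n (a : 'I_n.+1 -> K) (T : 'I_n.+1 -> gtype K) :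
  gweight (gsum (fun i => GScal (a i) (T i))) = \sum_i a i * gweight (T i).
Proof.
elim: n a T => [|n IH] a T; first by rewrite /= big_ord_recl big_ord0 addr0.
by rewrite /= (IH (fun i => a (lift ord0 i))) [RHS]big_ord_recl.
Qed.

Lemma basis_gweight b G T : basis b -> typed G b T -> gweight T = 1.
Proof.
move=> bb; move: G T; apply: (typed_generation (t := b)).
- by move=> G T R <- /gweight_tyeq.
- by move=> G k n a U <-; rewrite !gweight_gsum.
- by move=> G A n a U <-; rewrite !gweight_gsum.
- move=> G n a T a1 w1; rewrite gweight_gsum -[RHS]a1.
  by apply: eq_bigr => i _; rewrite w1 mulr1.
- by move=> G T H; case: H bb.
Qed.

Fixpoint gatoms (p : utype K -> Prop) (T : gtype K) : Prop :=
  match T with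
  | GUnit U => p U
  | GScal _ T1 => gatoms p T1
  | GPlus T1 T2 => gatoms p T1 /\ gatoms p T2
  | GVar _ => False
  end.

Lemma gatoms_tyeq (p : utype K -> Prop) T R :
  (forall U V, tyeq (GUnit U) (GUnit V) -> p U <-> p V) ->
  tyeq T R -> gatoms p T <-> gatoms p R.
Proof.
move=> pP; elim=> {T R} //=; try tauto.
- by move=> U U' T T' eU _ eT _; apply/pP/tyeq_UArr.
- by move=> k U U' eU _; apply/pP/tyeq_UAll.
Qed.

Lemma gatoms_gsum (p : utype K -> Prop) n (a : 'I_n.+1 -> K)
    (T : 'I_n.+1 -> gtype K) :
  gatoms p (gsum (fun i => GScal (a i) (T i))) <-> forall i, gatoms p (T i).
Proof.
elim: n a T => [|n IH] a T /=.
  by split=> [p0 i|]; [rewrite (ord1 i)|apply].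
rewrite (IH (fun i => a (lift ord0 i))); split=> [[p0 pn] i|pT]; last by [].
by case: (unliftP ord0 i) => [j|] ->.
Qed.

Lemma typed_unit_forallI k G t U :
  typed (map (ushift k) G) t (GUnit U) -> typed G t (GUnit (UAll k U)).
Proof.
move=> tU; apply: ty_equiv (tyeq_sym (tyeq_one _)).
apply: (@ty_forallI K G t 0 (fun=> 1) k (fun=> U)).
exact: ty_equiv tU (tyeq_one _).
Qed.

Lemma typed_unit_forallE A G t U :
  typed G t (GUnit (UAll (kind_of A) U)) -> typed G t (GUnit (uinst [:: A] U)).
Proof.
move=> tU; apply: ty_equiv (tyeq_sym (tyeq_one _)).
apply: (@ty_forallE K G t 0 (fun=> 1) _ (fun=> U) A erefl).
exact: ty_equiv tU (tyeq_one _).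
Qed.

Lemma typed_tyeq G t T R : tyeq T R -> typed G t T <-> typed G t R.
Proof.
by move=> e; split=> ty; apply: ty_equiv ty _; [apply: tyeq_sym|].
Qed.

Lemma basis_gatoms b G T :
  basis b -> typed G b T -> gatoms (fun U => typed G b (GUnit U)) T.
Proof.
move=> bb; move: G T; apply: (typed_generation (t := b)).
- move=> G T R + e; apply: (iffRL (gatoms_tyeq _ e)) => U V.
  exact: typed_tyeq.
- move=> G k n a U /gatoms_gsum tU; apply/gatoms_gsum => i.
  exact: typed_unit_forallI (tU i).
- move=> G A n a U /gatoms_gsum tU; apply/gatoms_gsum => i.
  exact: typed_unit_forallE (tU i).
- by move=> G n a T a1 tT; apply/gatoms_gsum.
- move=> G T H; case: H bb => //= *; [exact: ty_ax|exact: ty_arrI].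
Qed.

Fixpoint lam_type t G U : Prop :=
  match U with
  | UVar _ => False
  | UArr U1 T => typed (U1 :: G) t T
  | UAll k U1 => lam_type t (map (ushift k) G) U1
  end.

Lemma lam_type_tyeq t G U V :
  tyeq (GUnit U) (GUnit V) -> lam_type t G U <-> lam_type t G V.
Proof.
move=> e; suff: forall T R, tyeq T R ->
    forall G, gatoms (lam_type t G) T <-> gatoms (lam_type t G) R.
  by move=> /(_ _ _ e G).
move=> {}T {}R {}e; elim: e => {T R} /=; try by move=> *; tauto.
- by move=> T R _ IH {}G; rewrite IH.
- by move=> T R Q _ IH1 _ IH2 {}G; rewrite IH1.
- by move=> _ T T' _ IH {}G.
- by move=> T T' R R' _ IH1 _ IH2 {}G; rewrite IH1 IH2.
- move=> U1 U2 T1 T2 eU _ eT _ {}G; rewrite (typed_tyeq _ _ eT).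
  by split; apply: typed_ctx_eq => //; apply: tyeq_sym.
- by move=> k U1 U2 _ IH {}G.
Qed.

Lemma lam_type_subst su sg t G U :
  lam_type t G U -> lam_type t (map (usubst su sg) G) (usubst su sg U).
Proof.
elim: U su sg G => [n|U _ T|k U IH] //= su sg G; first exact: typed_subst_types.
move=> /(IH (upu k su) (upg k sg)); congr lam_type.
by rewrite -!map_comp; apply: eq_map => V /=; apply: subst_ushift.
Qed.

Lemma map_uinst_ushift A G :
  map (uinst [:: A]) (map (ushift (kind_of A)) G) = G.
Proof.
rewrite -map_comp -[RHS]map_id; apply: eq_map => V /=.
exact: (uinst_ushifts [:: A]).
Qed.

Lemma lam_gatoms t G T : typed G (Lam t) T -> gatoms (lam_type t G) T.
Proof.
move: G T; apply: (typed_generation (t := Lam t)).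
- move=> G T R + e; apply: (iffRL (gatoms_tyeq _ e)) => U V.
  exact: lam_type_tyeq.
- by move=> G k n a U /gatoms_gsum tU; apply/gatoms_gsum => i; apply: tU i.
- move=> G A n a U /gatoms_gsum tU; apply/gatoms_gsum => i /=.
  by rewrite -[G](map_uinst_ushift A); apply: lam_type_subst; apply: tU i.
- by move=> G n a T a1 tT; apply/gatoms_gsum.
- by move=> G T H; inversion H.
Qed.

Lemma lam_type_foralls t G Xs U T :
  lam_type t G (foralls Xs (UArr U T)) ->
  typed (U :: map (ushifts Xs) G) t T.
Proof.
elim: Xs G => [|k Xs IH] G /=; first by rewrite map_id.
by move=> /IH; rewrite -map_comp.
Qed.

Lemma lam_inst t G As U T :
  lam_type t G (foralls (map (@kind_of K) As) (UArr U T)) ->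
  typed (uinst As U :: G) t (ginst As T).
Proof.
move=> /lam_type_foralls/(typed_subst_types (inst_u As) (inst_g As)) /=.
congr (typed (_ :: _) _ _); rewrite -map_comp -[RHS]map_id.
by apply: eq_map => V /=; apply: uinst_ushifts.
Qed.

Lemma typed_subst1 G b t U T :
  typed G b (GUnit U) -> typed (U :: G) t T -> typed G (subst1 b t) T.
Proof.
move=> tb; apply: typed_subst => -[|x] V /=; first by move=> [<-].
exact: ty_ax.
Qed.

(** * Subject reduction *)

Lemma typed_beta G t b T :
  basis b -> typed G (App (Lam t) b) T -> typed G (subst1 b t) T.
Proof.
move=> bb; move: G T; apply: typed_transfer => G T0 H.
inversion H; subst => {H}.
have /gatoms_gsum lt := lam_gatoms H4.
have /gatoms_gsum lb := basis_gatoms bb H6.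
have ty i j : typed G (subst1 b t) (ginst (As j) (T i)).
  apply: typed_subst1 (lb j) _; apply: lam_inst; rewrite H2; exact: lt i.
have a1 : \sum_i a i = 1.
  rewrite -(basis_gweight (b := Lam t) isT H4) gweight_gsum.
  by apply: eq_bigr => i _; rewrite mulr1.
have b1 : \sum_j b0 j = 1.
  rewrite -(basis_gweight bb H6) gweight_gsum.
  by apply: eq_bigr => i _; rewrite mulr1.
apply: ty_equiv (typed_affine a1 (fun i => typed_affine b1 (ty i))) _.
apply: gsum_eq => i; apply: tyeq_trans (tyeq_sym (gsum_scal _ _)).
by apply: gsum_eq => j; apply/tyeq_sym/tyeq_scal.
Qed.

Lemma typed_dist G a t r T :
  typed G (Scal a (Plus t r)) T -> typed G (Plus (Scal a t) (Scal a r)) T.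
Proof.
move=> /typed_scalE ty.
suff [T1 [T2 [t1 t2 e]]] : exists T1 T2,
    [/\ comb (typed G t) a T1, comb (typed G r) a T2 & tyeq T (GPlus T1 T2)].
  by apply: ty_equiv e; apply: ty_plusI; apply: typed_scal_comb.
elim/comb_ind: ty => [{}a {}T /typed_plusE[T1 [T2 [t1 t2 e]]]
  |a1 a2 R1 R2 [T1 [T2 [t1 t2 e]]] [S1 [S2 [s1 s2 e']]]
  |{}a {}T R [T1 [T2 [t1 t2 e]]] e'].
- exists (GScal a T1), (GScal a T2); split; [exact: comb_leaf..|].
  by apply: tyeq_trans (tyeq_GScal a e) _; apply/tyeq_sym/tyeq_dist.
- exists (GPlus T1 S1), (GPlus T2 S2); split; [exact: comb_plus..|].
  by apply: tyeq_trans (tyeq_GPlus e e') _; apply: tyeq_plusACA.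
- by exists T1, T2; split=> //; apply: tyeq_trans e' e.
Qed.

Lemma typed_fact G a b t r s T :
  (forall R, typed G r R -> comb (typed G t) a R) ->
  (forall R, typed G s R -> comb (typed G t) b R) ->
  typed G (Plus r s) T -> typed G (Scal (a + b) t) T.
Proof.
move=> rt st /typed_plusE[T1 [T2 [/rt t1 /st t2 e]]].
by apply: ty_equiv e; apply: typed_scal_comb; apply: comb_plus.
Qed.

Lemma lrel_app_l G t r T :
  intro_typed G (App t r) T ->
  exists J (ok : J -> Prop) (f : J -> utype K) g,
    (exists2 R, typed G t R & lrel ok f g R T) /\
    (forall t' R S, typed G t' R -> lrel ok f g R S -> typed G (App t' r) S).
Proof.
move=> H; inversion H; subst => {H}.
exists (gtype K), (fun=> True), (fun T => foralls (map (@kind_of K) (As ord0)) (UArr U T)),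
  (fun T => gsum (fun j => GScal (b j) (ginst (As j) T))).
have kAs j : map (@kind_of K) (As j) = map (@kind_of K) (As ord0).
  by rewrite !H2.
split; last by move=> t' R S tR RS; apply: typed_app_lrel_l kAs tR RS H6.
eexists; first exact: H4.
rewrite H2; apply: lrel_eq (lrel_gsum _ _ a (j := T0) (fun=> I)) (tyeq_refl _) _.
apply: gsum_eq => i; apply: tyeq_trans (tyeq_sym (gsum_scal _ _)).
by apply: gsum_eq => j; apply/tyeq_sym/tyeq_scal.
Qed.

Lemma lrel_app_r G t r T :
  intro_typed G (App t r) T ->
  exists J (ok : J -> Prop) (f : J -> utype K) g,
    (exists2 R, typed G r R & lrel ok f g R T) /\
    (forall r' R S, typed G r' R -> lrel ok f g R S -> typed G (App t r') S).
Proof.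
move=> H; inversion H; subst => {H}.
do 4!eexists; split; last by move=> r' R S; apply: typed_app_lrel_r H4.
eexists; first exact: H6.
apply: lrel_eq (lrel_gsum _ _ _ H2) (tyeq_refl _) _.
apply: tyeq_trans (gsum_exchange _) _; apply: gsum_eq => j.
apply: tyeq_trans (tyeq_sym (gsum_scal _ _)); apply: gsum_eq => i.
by rewrite mulrC; apply/tyeq_sym/tyeq_scal.
Qed.

Lemma typed_plus_app G t r u T :
  typed G (App (Plus t r) u) T -> typed G (Plus (App t u) (App r u)) T.
Proof.
move: G T; apply: typed_transfer => G T /lrel_app_l[J [ok [f [g [[R tR RT] ap]]]]].
have [T1 [T2 [t1 t2 e]]] := typed_plusE tR.
have := lrel_eq RT (tyeq_sym e) (tyeq_refl _).
move=> /lrel_plus_inv[S1 [S2 [r1 r2 e']]]; apply: ty_equiv e'.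
exact: ty_plusI (ap _ _ _ t1 r1) (ap _ _ _ t2 r2).
Qed.

Lemma typed_app_plus G t r u T :
  typed G (App t (Plus r u)) T -> typed G (Plus (App t r) (App t u)) T.
Proof.
move: G T; apply: typed_transfer => G T /lrel_app_r[J [ok [f [g [[R tR RT] ap]]]]].
have [T1 [T2 [t1 t2 e]]] := typed_plusE tR.
have := lrel_eq RT (tyeq_sym e) (tyeq_refl _).
move=> /lrel_plus_inv[S1 [S2 [r1 r2 e']]]; apply: ty_equiv e'.
exact: ty_plusI (ap _ _ _ t1 r1) (ap _ _ _ t2 r2).
Qed.

Lemma typed_scal_app G a t r T :
  typed G (App (Scal a t) r) T -> typed G (Scal a (App t r)) T.
Proof.
move: G T; apply: typed_transfer => G T /lrel_app_l[J [ok [f [g [[R tR RT] ap]]]]].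
apply: typed_scal_comb; apply: comb_sub (comb_lrel (typed_scalE tR) RT).
by move=> S [R']; apply: ap.
Qed.

Lemma typed_app_scal G a t r T :
  typed G (App t (Scal a r)) T -> typed G (Scal a (App t r)) T.
Proof.
move: G T; apply: typed_transfer => G T /lrel_app_r[J [ok [f [g [[R tR RT] ap]]]]].
apply: typed_scal_comb; apply: comb_sub (comb_lrel (typed_scalE tR) RT).
by move=> S [R']; apply: ap.
Qed.

End Typing.

Theorem theorem1 (K : comPzRingType) (t t' : term K) (G : ctx K) (T : gtype K) :
  step t t' -> typed G t T -> typed G t' T.
Proof.
move=> st; elim: st G T => {t t'}.
- by move=> t G T; apply: ty_oneE.
- move=> a b t G T /typed_scalE ty; apply: typed_scal_comb; apply: comb_bind.
  by apply: comb_sub ty => R /typed_scalE.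
- by move=> a t r G T; apply: typed_dist.
- by move=> a b t G T; apply: typed_fact => R /typed_scalE.
- by move=> a t G T; apply: typed_fact => R; [move=> /typed_scalE|apply: comb_in].
- by move=> t G T; apply: typed_fact => R; apply: comb_in.
- by move=> t r u G T; apply: typed_plus_app.
- by move=> t r u G T; apply: typed_app_plus.
- by move=> a t r G T; apply: typed_scal_app.
- by move=> a t r G T; apply: typed_app_scal.
- by move=> t b bb G T; apply: typed_beta.
- move=> a t t' _ IH G T /typed_scalE ty; apply: typed_scal_comb.
  by apply: comb_sub ty => R; apply: IH.
- move=> u t t' _ IH G T /typed_plusE[T1 [T2 [tu /IH tt' e]]].
  by apply: ty_equiv e; apply: ty_plusI.
- move=> u t t' _ IH; apply: typed_transfer => G T.
  by move=> /lrel_app_r[J [ok [f [g [[R /IH tR RT] ap]]]]]; apply: ap tR RT.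
- move=> u t t' _ IH; apply: typed_transfer => G T.
  by move=> /lrel_app_l[J [ok [f [g [[R /IH tR RT] ap]]]]]; apply: ap tR RT.
- move=> t t' _ IH; apply: typed_transfer => G T H; inversion H; subst.
  by apply: ty_arrI; apply: IH.
Qed.
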